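(* Let $m,n\ge1$, $H\in\mathbb S_{++}^{mn}$, $P=P_{\mathcal K}(H)$, $S=P^{-1/2}HP^{-1/2}$, and let $E_+$, $E_-$ be the eigenspaces of $S$ for its largest and smallest eigenvalue. Define $$\mathcal D_\pm=\{Q\in\mathbb S^{mn}: Q\succeq0,\ \operatorname{tr}Q=1,\ \operatorname{range}(Q)\subseteq E_\pm\}$$ and the compact convex set $$\mathcal G(P)=\{\Pi_{\mathcal L}(Q_--Q_+):Q_+\in\mathcal D_+,\ Q_-\in\mathcal D_-\}.$$ Let $g_\star$ be the unique element of $\mathcal G(P)$ of minimum Frobenius norm, and set $\mu_{\mathrm{marg}}(P)=\|g_\star\|_F$. Then $$\mu_{\mathrm{marg}}(P)=0\iff P\in\operatorname*{arg\,min}_{G\in\mathcal K_{m,n}}\log\kappa(G^{-1}H).$$ If $\mu_{\mathrm{marg}}(P)>0$, then the curve $G_t=P^{1/2}\exp(-tg_\star)P^{1/2}$ is a geodesic in $\mathcal K_{m,n}$ and satisfies $$\frac{\mathrm d}{\mathrm dt}\bigg|_{t=0+}\log\kappa(G_t^{-1}H)=-\mu_{\mathrm{marg}}(P)^2.$$ If the extreme eigenvalues of $S$ are simple with unit eigenvectors $u_+$ (largest) and $u_-$ (smallest), then $g_\star=\Pi_{\mathcal L}(u_-u_-^\top-u_+u_+^\top)$. In general (with multiplicity), $g_\star=\Pi_{\mathcal L}(Q_--Q_+)$ for any solution $(Q_+,Q_-)$ of the finite-dimensional convex conic problem of minimizing $\|\Pi_{\mathcal L}(Q_--Q_+)\|_F$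 over $(Q_+,Q_-)\in\mathcal D_+\times\mathcal D_-$.
   Context: $\mathbb S^d$ denotes real symmetric $d\times d$ matrices and $\mathbb S_{++}^d$ the positive-definite ones. The affine-invariant distance is $d_{\mathrm{AI}}(G_0,G_1)=\|\log(G_0^{-1/2}G_1G_0^{-1/2})\|_F$; it is the distance of the affine-invariant Riemannian metric $\|Z\|_{S,\mathrm{AI}}=\|S^{-1/2}ZS^{-1/2}\|_F$. For $G,H\in\mathbb S_{++}^d$, $\kappa(G^{-1}H)$ is the ratio of the largest to the smallest generalized eigenvalue in $Hv=\lambda Gv$. The Kronecker family is $\mathcal K_{m,n}=\{B\otimes A: A\in\mathbb S_{++}^m,\ B\in\mathbb S_{++}^n\}\subset\mathbb S_{++}^{mn}$. For every $M\in\mathbb S_{++}^{mn}$ there is a unique point $P_{\mathcal K}(M)=\operatorname*{arg\,min}_{G\in\mathcal K_{m,n}}d_{\mathrm{AI}}(M,G)$. The log-Kronecker subspace is $\mathcal L_{m,n}=\{I_n\otimes X+Y\otimes I_m: X\in\mathbb S^m,\ Y\in\mathbb S^n\}\subset\mathbb S^{mn}$, and $\Pi_{\mathcal L}$ is the Frobenius-orthogonal projection of $\mathbb S^{mn}$ onto it. *)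

(* Defs.v *)
From HB Require Import structures.
From mathcomp Require Import all_boot all_order all_algebra.
From mathcomp Require Import all_classical all_reals all_analysis.
From mathcomp Require Import mxtens.

Set Implicit Arguments.
Unset Strict Implicit.
Unset Printing Implicit Defensive.

Import Order.TTheory GRing.Theory Num.Theory.
Import numFieldNormedType.Exports.

Local Open Scope classical_set_scope.
Local Open Scope ring_scope.

Definition argmin (R : realType) (T : Type) (A : set T) (f : T -> R) : set T :=
  [set x | A x /\ forall y, A y -> f x <= f y].

Definition right_derivative (R : realType) (f : R -> R) (a l : R) : Prop :=
  (fun t => t^-1 * (f (a + t) - f a)) @ 0^'+ --> l.

Section SymmetricMatrices.
Variables (R : realType) (d : nat).
Implicit Types (A B G H S Q X Z W : 'M[R]_d).

Definition psd A : Prop :=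
  A \is symmetricmx /\ forall v : 'cV[R]_d, 0 <= (v^T *m A *m v) 0 0.

Definition spd A : Prop :=
  A \is symmetricmx /\
  forall v : 'cV[R]_d, v != 0 -> 0 < (v^T *m A *m v) 0 0.

(* Spectral functional calculus: if A = U^T diag(x) U with U orthogonal, then
   funcalc f A = U^T diag(f x) U, whatever the chosen decomposition (funcalcE).
   The default value 0 is only reached when A is not symmetric. *)
Definition funcalc (f : R -> R) A : 'M[R]_d :=
  xget 0 [set B | exists (U : 'M[R]_d) (x : 'rV[R]_d),
    [/\ U *m U^T = 1%:M, A = U^T *m diag_mx x *m U
      & B = U^T *m diag_mx (map_mx f x) *m U]].

Definition sqrtm := funcalc (@Num.sqrt R).
Definition logm := funcalc (@ln R).
Definition expm := funcalc (@expR R).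

Lemma funcalcE (f : R -> R) (U : 'M[R]_d) (x : 'rV[R]_d) :
  U *m U^T = 1%:M ->
  funcalc f (U^T *m diag_mx x *m U) = U^T *m diag_mx (map_mx f x) *m U.
Proof.
move=> UU; rewrite /funcalc; set P := [set B | _].
suff uniqP : forall B, P B -> B = U^T *m diag_mx (map_mx f x) *m U.
  by apply: uniqP; apply: (xgetPex 0); eexists; exists U, x; split.
move=> _ [V] [y] [VV AE ->].
have VV' : V^T *m V = 1%:M by exact: mulmx1C.
have UU' : U^T *m U = 1%:M by exact: mulmx1C.
pose W := V *m U^T.
have WE : W *m diag_mx x = diag_mx y *m W.
  have := congr1 (fun M => V *m M *m U^T) AE.
  rewrite -!mulmxA UU mulmx1 (mulmxA V V^T) VV mul1mx mulmxA => ->.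
  by rewrite /W.
have WfE : W *m diag_mx (map_mx f x) = diag_mx (map_mx f y) *m W.
  apply/matrixP => i j; have /matrixP/(_ i j) := WE.
  rewrite !mul_mx_diag !mul_diag_mx !mxE [LHS]mulrC => /eqP.
  rewrite -subr_eq0 -mulrBl mulf_eq0 subr_eq0 => /orP[/eqP -> | /eqP ->].
    by rewrite mulrC.
  by rewrite mulr0 mul0r.
have -> : diag_mx (map_mx f y) = W *m diag_mx (map_mx f x) *m W^T.
  by rewrite WfE /W trmx_mul trmxK -!mulmxA (mulmxA U^T) UU' mul1mx VV mulmx1.
rewrite /W trmx_mul trmxK !mulmxA VV' mul1mx -!mulmxA VV' mulmx1 //.
Qed.

Definition frob (p q : nat) (X : 'M[R]_(p, q)) : R :=
  Num.sqrt (\tr (X^T *m X)).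

(* G0^{-1/2} G1 G0^{-1/2} *)
Definition whiten G0 G1 : 'M[R]_d :=
  invmx (sqrtm G0) *m G1 *m invmx (sqrtm G0).

Definition aidist G0 G1 : R := frob (logm (whiten G0 G1)).

(* The minimizing constant-speed curves of the affine-invariant distance lying
   in K. Since d_AI makes the positive-definite cone a Hadamard manifold, its
   Riemannian geodesics are exactly the curves along which d_AI(g(s), g(t)) is
   proportional to |t - s|; such a curve staying in K is also a geodesic of K
   for the induced metric. *)
Definition geodesic_in (K : set 'M[R]_d) (g : R -> 'M[R]_d) : Prop :=
  (forall t, K (g t)) /\
  exists2 c : R, 0 <= c & forall s t, aidist (g s) (g t) = c * `|t - s|.

Definition gen_eigenvalues G H : set R :=
  [set l | exists2 v : 'cV[R]_d, v != 0 & H *m v = l *: (G *m v)].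

(* kappa G H is the kappa(G^{-1} H). For d > 0 the sets below are
   finite and nonempty, so sup and inf are a maximum and a minimum. *)
Definition kappa G H : R := sup (gen_eigenvalues G H) / inf (gen_eigenvalues G H).

Definition lmax S : R := sup [set a | eigenvalue S a].
Definition lmin S : R := inf [set a | eigenvalue S a].

(* Density matrices supported on the a-eigenspace of S. Both eigenspace and
   (_ <= _)%MS speak of row spaces, which are the column spaces here because Q
   and S are symmetric. *)
Definition densities S (a : R) : set 'M[R]_d :=
  [set Q | [/\ psd Q, \tr Q = 1 & (Q <= eigenspace S a)%MS]].

(* Frobenius-orthogonal projection onto a linear subspace V. *)
Definition orth_proj (V : set 'M[R]_d) X : 'M[R]_d :=
  xget 0 [set Z | V Z /\ forall W, V W -> \tr (W^T *m (X - Z)) = 0].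

End SymmetricMatrices.

Section Kronecker.
Variables (R : realType) (m n : nat).

(* [B *t A] is the usual Kronecker product: entry (i m + k, j m + l) is
   B i j * A k l. *)
Definition kron_family : set 'M[R]_(n * m) :=
  [set G | exists (A : 'M[R]_m) (B : 'M[R]_n), [/\ spd A, spd B & G = B *t A]].

Definition log_kron : set 'M[R]_(n * m) :=
  [set Z | exists (X : 'M[R]_m) (Y : 'M[R]_n),
    [/\ X \is symmetricmx, Y \is symmetricmx
      & Z = (1%:M : 'M[R]_n) *t X + Y *t (1%:M : 'M[R]_m)]].

Definition proj_log_kron : 'M[R]_(n * m) -> 'M[R]_(n * m) := orth_proj log_kron.

Definition Dplus (S : 'M[R]_(n * m)) := densities S (lmax S).
Definition Dminus (S : 'M[R]_(n * m)) := densities S (lmin S).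

Definition marg_set (S : 'M[R]_(n * m)) : set 'M[R]_(n * m) :=
  [set proj_log_kron (Q.2 - Q.1) | Q in Dplus S `*` Dminus S].

End Kronecker.

(* Main.v *)
Require Import Defs.
From HB Require Import structures.
From mathcomp Require Import all_boot all_order all_algebra.
From mathcomp Require Import all_classical all_reals all_analysis.
From mathcomp Require Import mxtens ring lra.

(** Write C for the square root of P, so that H = C S C. Every member of the
    Kronecker family is C e^Z C with Z in the log-Kronecker subspace L, because
    the family is the exponential of L (expm_kron_sum) and is closed under
    congruence by its own square roots and inverses. A congruence does not
    change generalized eigenvalues, so the condition number of the pair
    (C e^Z C, H) is that of the pair (e^Z, S), and everything becomes a
    statement about phi(Z) = ln kappa(e^Z, S) on L near Z = 0.

    The function phi lies above its linearizations: for density matrices Q+ and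
    Q- on the extreme eigenspaces of S,
      phi(Z) >= phi(0) + tr ((Q- - Q+) Z)          (ln_kappa_ge).
    Indeed the extreme generalized eigenvalues a and b satisfy
    b e^Z <= S <= a e^Z. Pairing the first inequality with Q-, and the inverse
    e^(- Z) <= a S^-1 of the second with Q+, bounds b from above and a from
    below, because tr (Q e^Z) >= exp (tr (Q Z)) by Jensen (jensen_expm).
    For Z in L only the projection of Q- - Q+ matters. Hence if 0 belongs to the
    marginal set, Z = 0 minimizes phi on L, which is one half of the criterion.

    Let g be the minimum-norm element, attained at (Q+, Q-). Convexity of the
    marginal set gives the variational inequality <g', g> >= |g|^2 for all g' in
    it (min_norm_variational), with equality at (Q+, Q-). The lower bound at
    Z = - t g is then phi(0) - t |g|^2. For the matching upper bound, rank-one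
    densities u u^T turn the variational inequality into bounds on u^T g u over
    unit eigenvectors for the extreme eigenvalues; a compactness argument on the
    unit sphere (loewner_perturb) extends them, up to an arbitrarily small loss
    in the slope, to the extreme eigenvalues of the pair (e^(- t g), S) for small
    t > 0. Together the two bounds give the right derivative - |g|^2
    (ln_kappa_descent), and in particular phi decreases along - g when g != 0,
    the other half of the criterion.

    The curve is a geodesic because whitening C e^(t Z) C by C e^(s Z) C gives an
    orthogonal conjugate of e^((t - s) Z) (aidist_expm). Uniqueness of g settles
    the description by minimizing pairs, and on a one-dimensional eigenspace
    there is only one density (density_simple). *)

Import Order.TTheory GRing.Theory Num.Theory.
Import numFieldNormedType.Exports.

Local Open Scope classical_set_scope.
Local Open Scope ring_scope.

Set Implicit Arguments.
Unset Strict Implicit.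
Unset Printing Implicit Defensive.

(** * Continuity and compactness in matrix spaces *)

Section MatrixTopology.
Variable R : realType.

(** Neighbourhoods of a matrix are generated by neighbourhoods of its entries. *)
Lemma continuous_mx (T : topologicalType) p q (f : T -> 'M[R]_(p, q)) :
  (forall i j, continuous (fun x => f x i j)) -> continuous f.
Proof.
move=> cf x A [P fxP sPA]; rewrite nbhs_simpl /=.
apply: (@filterS _ _ _ [set y | forall i j, P i j (f y i j)]).
  by move=> y Py; apply: sPA.
suff: \forall y \near x, forall ij : 'I_p * 'I_q, P ij.1 ij.2 (f y ij.1 ij.2).
  by apply: filterS => y Py i j; exact: (Py (i, j)).
by apply: filter_forall => -[i j]; exact: (cf i j x _ (fxP i j)).
Qed.

Lemma continuous_sum (T : topologicalType) (I : finType) (f : I -> T -> R) :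
  (forall i, continuous (f i)) -> continuous (fun x => \sum_i f i x).
Proof.
move=> cf; elim: (index_enum I) => [|i r IHr].
  by under eq_fun do rewrite big_nil; exact: cst_continuous.
by under eq_fun do rewrite big_cons; move=> x; apply: continuousD; [exact: cf|exact: IHr].
Qed.

Lemma coordM_continuous p q i j (c : R) :
  continuous (fun A : 'M[R]_(p, q) => A i j * c).
Proof.
by move=> A; exact: cvgMr_tmp (@coord_continuous R p q i j A).
Qed.

Lemma linear_mxmx_continuous p q r s (f : {linear 'M[R]_(p, q) -> 'M[R]_(r, s)}) :
  continuous f.
Proof.
apply: continuous_mx => i j.
have -> : (fun x => f x i j) =
    fun A => \sum_k \sum_l A k l * f (delta_mx k l) i j.
  apply/funext => A; rewrite {1}(matrix_sum_delta A) linear_sum summxE.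
  apply: eq_bigr => k _; rewrite linear_sum summxE; apply: eq_bigr => l _.
  by rewrite linearZ mxE.
apply: continuous_sum => k; apply: continuous_sum => l.
exact: coordM_continuous.
Qed.

(** The Heine-Borel property of row vectors, carried over by the linear
    bijection vec_mx. *)
Lemma bounded_closed_compact_mx p q (A : set 'M[R]_(p, q)) (c : R) :
  (forall X, A X -> forall i j, `|X i j| <= c) -> closed A -> compact A.
Proof.
move=> Ac clA.
have cvec : continuous (vec_mx : 'rV[R]_(p * q) -> 'M[R]_(p, q)).
  exact: linear_mxmx_continuous.
have -> : A = vec_mx @` (vec_mx @^-1` A).
  apply/seteqP; split => [X AX|_ [v vA <-]//].
  by exists (mxvec X); rewrite /= mxvecK.
apply: continuous_compact; first exact: continuous_subspaceT.
apply: bounded_closed_compact; last first.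
  by apply: preimage_closed => //; move=> ? _; exact: cvec.
exists (Num.max 0 c); split; first exact: num_real.
move=> M cM v Av; rewrite /= [X in X <= _]/Num.Def.normr /= mx_normrE.
have [c0 ccM] : 0 <= M /\ c <= M.
  by move: cM; rewrite gt_max => /andP[/ltW ? /ltW ?].
apply/bigmax_leP; split => // -[i k] _ /=.
rewrite (ord1 i); case/mxvec_indexP: k => k l.
by apply: le_trans ccM; rewrite -[v]vec_mxK mxvecE; exact: Ac.
Qed.

End MatrixTopology.

(** * Quadratic forms and positive semidefinite matrices *)

Local Notation qf A v := ((v^T *m A *m v) 0 0).

Section Quadratic.
Variables (R : realType) (d : nat).
Implicit Types (A B G H S Q X Z : 'M[R]_d) (u v w : 'cV[R]_d).

Lemma symmxP A : reflect (A^T = A) (A \is symmetricmx).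
Proof.
apply: (iffP (is_hermitianmxP _ _ _)); rewrite expr0 scale1r map_mx_id //.
Qed.

Lemma qfE A v : qf A v = \sum_i \sum_j v i 0 * A i j * v j 0.
Proof.
rewrite mxE exchange_big /=; apply: eq_bigr => j _; rewrite mxE big_distrl /=.
by apply: eq_bigr => i _; rewrite mxE.
Qed.

Lemma qf_trace A v : qf A v = \tr (v *m v^T *m A).
Proof. by rewrite -trace_mx11 mxtrace_mulC mulmxA. Qed.

Lemma qfD A B v : qf (A + B) v = qf A v + qf B v.
Proof. by rewrite mulmxDr mulmxDl mxE. Qed.

Lemma qfN A v : qf (- A) v = - qf A v.
Proof. by rewrite mulmxN mulNmx mxE. Qed.

Lemma qfZ a A v : qf (a *: A) v = a * qf A v.
Proof. by rewrite -scalemxAr -scalemxAl mxE. Qed.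

Lemma qfZv A a v : qf A (a *: v) = a ^+ 2 * qf A v.
Proof. by rewrite -scalemxAr linearZ /= -!scalemxAl !mxE mulrA. Qed.

Lemma qf_congr (C A : 'M[R]_d) v : qf (C^T *m A *m C) v = qf A (C *m v).
Proof. by rewrite trmx_mul !mulmxA. Qed.

Lemma dotE v : (v^T *m v) 0 0 = \sum_i v i 0 ^+ 2.
Proof. by rewrite mxE; apply: eq_bigr => i _; rewrite mxE. Qed.

Lemma qf1 v : qf 1%:M v = \sum_i v i 0 ^+ 2.
Proof. by rewrite mulmx1 dotE. Qed.

Lemma qf1_ge0 v : 0 <= qf 1%:M v.
Proof. by rewrite qf1; apply: sumr_ge0 => i _; exact: sqr_ge0. Qed.

Lemma qf1_eq0 v : (qf 1%:M v == 0) = (v == 0).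
Proof.
apply/idP/eqP => [|->]; last by rewrite mulmx0 mxE.
rewrite qf1 psumr_eq0 => [/allP v0|i _]; last exact: sqr_ge0.
apply/colP => i; rewrite mxE; apply/eqP.
by have := v0 i (mem_index_enum _); rewrite sqrf_eq0.
Qed.

Lemma qf1_gt0 v : v != 0 -> 0 < qf 1%:M v.
Proof. by move=> v0; rewrite lt_def qf1_eq0 v0 qf1_ge0. Qed.

Lemma frob_qf1 v : frob v = 1 -> qf 1%:M v = 1.
Proof.
rewrite mulmx1 /frob trace_mx11 => /(congr1 (fun x => x ^+ 2)).
rewrite sqr_sqrtr ?expr1n //.
by rewrite dotE; apply: sumr_ge0 => i _; exact: sqr_ge0.
Qed.

Lemma qf_polar A u v (t : R) : A \is symmetricmx ->
  qf A (u + t *: v) = qf A u + t * (v^T *m A *m u) 0 0 *+ 2 + t ^+ 2 * qf A v.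
Proof.
move=> /symmxP symA.
have swap : u^T *m A *m v = (v^T *m A *m u)^T.
  by rewrite !trmx_mul trmxK symA mulmxA.
rewrite mulmxDr -scalemxAr [(u + _)^T]linearD /= [(_ *: v)^T]linearZ /=.
rewrite !mulmxDl -!scalemxAl swap !mxE.
ring.
Qed.

Lemma psd_sym A : psd A -> A \is symmetricmx. Proof. by case. Qed.
Lemma spd_sym A : spd A -> A \is symmetricmx. Proof. by case. Qed.

Lemma sym1 : (1%:M : 'M[R]_d) \is symmetricmx.
Proof. by apply/symmxP; rewrite trmx1. Qed.

Lemma symD A B : A \is symmetricmx -> B \is symmetricmx -> A + B \is symmetricmx.
Proof. by move=> /symmxP sA /symmxP sB; apply/symmxP; rewrite linearD /= sA sB. Qed.

Lemma symZ a A : A \is symmetricmx -> a *: A \is symmetricmx.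
Proof. by move=> /symmxP sA; apply/symmxP; rewrite linearZ /= sA. Qed.

Lemma symN A : A \is symmetricmx -> - A \is symmetricmx.
Proof. by rewrite -scaleN1r; exact: symZ. Qed.

Lemma symB A B : A \is symmetricmx -> B \is symmetricmx -> A - B \is symmetricmx.
Proof. by move=> sA sB; apply: symD => //; exact: symN. Qed.

Lemma sym_congr (C A : 'M[R]_d) : A \is symmetricmx -> C^T *m A *m C \is symmetricmx.
Proof. by move=> /symmxP sA; apply/symmxP; rewrite !trmx_mul trmxK sA mulmxA. Qed.

Lemma sym_inv A : A \is symmetricmx -> invmx A \is symmetricmx.
Proof. by move=> /symmxP sA; apply/symmxP; rewrite trmx_inv sA. Qed.

Lemma spd_psd A : spd A -> psd A.
Proof.
move=> [sA pA]; split=> // v; have [->|v0] := eqVneq v 0; last exact/ltW/pA.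
by rewrite mulmx0 mxE.
Qed.

Lemma spd1 : spd (1%:M : 'M[R]_d).
Proof. by split; [exact: sym1|exact: qf1_gt0]. Qed.

Lemma psdZ a A : 0 <= a -> psd A -> psd (a *: A).
Proof.
by move=> a0 [sA pA]; split; [exact: symZ|move=> v; rewrite qfZ mulr_ge0].
Qed.

Lemma spdZ a A : 0 < a -> spd A -> spd (a *: A).
Proof.
move=> a0 [sA pA]; split; first exact: symZ.
by move=> v v0; rewrite qfZ mulr_gt0 // pA.
Qed.

Lemma psdD A B : psd A -> psd B -> psd (A + B).
Proof.
by move=> [sA pA] [sB pB]; split; [exact: symD|move=> v; rewrite qfD addr_ge0].
Qed.

Lemma psd_congr (C A : 'M[R]_d) : psd A -> psd (C^T *m A *m C).
Proof.
by move=> [sA pA]; split; [exact: sym_congr|move=> v; rewrite qf_congr].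
Qed.

Lemma spd_congr (C A : 'M[R]_d) : C \in unitmx -> spd A -> spd (C^T *m A *m C).
Proof.
move=> uC [sA pA]; split; first exact: sym_congr.
move=> v v0; rewrite qf_congr; apply: pA; apply: contraNneq v0 => Cv0.
by rewrite -(mulKmx uC v) Cv0 mulmx0.
Qed.

Lemma spd_unit A : spd A -> A \in unitmx.
Proof.
move=> [/symmxP sA pA]; rewrite -row_free_unit -kermx_eq0; apply/rowV0P => w.
move=> /sub_kermxP wA; apply/eqP; rewrite -[w]trmxK trmx_eq0.
apply: contraT => /pA; rewrite trmxK wA mul0mx mxE ltxx //.
Qed.

Lemma spd_inv A : spd A -> spd (invmx A).
Proof.
move=> sA; have uA := spd_unit sA; have symA := symmxP _ (sym_inv (spd_sym sA)).
rewrite -[invmx A]mul1mx -(mulVmx uA) -{1}symA.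
by apply: spd_congr; rewrite ?unitmx_inv.
Qed.

Lemma psd_outer v : psd (v *m v^T).
Proof.
split; first by apply/symmxP; rewrite trmx_mul trmxK.
move=> w; rewrite mulmxA -mulmxA mxE big_ord1.
have -> : (v^T *m w) 0 0 = (w^T *m v)^T 0 0 by rewrite trmx_mul trmxK.
by rewrite [_^T _ _]mxE -expr2 sqr_ge0.
Qed.

(** A nonnegative form has a minimum at each of its zeros v, so its first-order
    variation vanishes there; the variation in the direction A v is twice the
    squared norm of A v. *)
Lemma psd_ker A v : psd A -> qf A v = 0 -> A *m v = 0.
Proof.
move=> [sA pA] qv0; apply/eqP; rewrite -qf1_eq0 eq_le qf1_ge0 andbT.
set w := A *m v; set a := qf 1%:M w.
have wAv : (w^T *m A *m v) 0 0 = a by rewrite /a mulmx1 /w !mulmxA.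
have pw := pA w; set b := qf A w in pw.
have b1 : 0 < b + 1 by rewrite ltr_wpDl.
(* nearly the minimiser of the form over the line v - t w; the denominator
   b + 1 stays positive even when b = 0 *)
have := pA (v + (- (a / (b + 1))) *: w).
rewrite (qf_polar _ _ _ sA) qv0 wAv -/b => h.
suff : a ^+ 2 * (2 * (b + 1) - b) <= 0.
  have -> : 2 * (b + 1) - b = b + 1 + 1 by ring.
  rewrite pmulr_lle0; last by lra.
  move=> a2; have /eqP : a ^+ 2 == 0 by rewrite eq_le a2 sqr_ge0.
  by move=> /eqP; rewrite sqrf_eq0 => /eqP ->.
have : 0 <= (b + 1) ^+ 2 * (0 + - (a / (b + 1)) * a *+ 2 + (- (a / (b + 1))) ^+ 2 * b).
  by rewrite mulr_ge0 // sqr_ge0.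
have -> : (b + 1) ^+ 2 * (0 + - (a / (b + 1)) * a *+ 2 + (- (a / (b + 1))) ^+ 2 * b)
  = - (a ^+ 2 * (2 * (b + 1) - b)) by field; rewrite gt_eqF.
by rewrite oppr_ge0.
Qed.

Lemma qf_continuous A : continuous (fun v => qf A v).
Proof.
under eq_fun do rewrite qfE.
apply: continuous_sum => i; apply: continuous_sum => j v.
have vi := @coord_continuous R d 1 i 0 v.
have vj := @coord_continuous R d 1 j 0 v.
exact: (cvgM (cvgMr_tmp (b := A i j) vi) vj).
Qed.

Definition sphere : set 'cV[R]_d := [set v | qf 1%:M v = 1].

Lemma sphere_compact : compact sphere.
Proof.
apply: (@bounded_closed_compact_mx _ _ _ _ 1).
  move=> v v1 i j; rewrite (ord1 j) -(expr_le1 (n := 2)) // real_normK ?num_real //.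
  rewrite -[leRHS]v1 qf1 (bigD1 i) //= lerDl.
  by apply: sumr_ge0 => k _; exact: sqr_ge0.
apply: (@preimage_closed _ _ (fun v => qf 1%:M v) [set 1]); last exact: closed_eq.
move=> v _; exact: qf_continuous.
Qed.

Lemma sphere_normalize v : v != 0 ->
  exists2 c, c != 0 & sphere (c *: v).
Proof.
move=> v0; have q0 := qf1_gt0 v0; exists (Num.sqrt (qf 1%:M v))^-1.
  by rewrite invr_neq0 // gt_eqF // sqrtr_gt0.
by rewrite /sphere /= qfZv exprVn sqr_sqrtr ?(ltW q0) // mulVf // gt_eqF.
Qed.

Lemma psd_sphere A : A \is symmetricmx ->
  (forall v, sphere v -> 0 <= qf A v) -> psd A.
Proof.
move=> sA pA; split=> // v; have [->|v0] := eqVneq v 0.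
  by rewrite mulmx0 mxE.
have [c c0 /pA] := sphere_normalize v0.
by rewrite qfZv pmulr_rge0 // exprn_even_gt0.
Qed.

(** A maximizer v of the Rayleigh quotient on the sphere, with value l, is
    a zero of the semidefinite form l - A, so that psd_ker makes it an
    eigenvector. *)
Lemma rayleigh_max A : (0 < d)%N -> A \is symmetricmx ->
  exists l, psd (l%:M - A) /\ exists2 v, sphere v & A *m v = l *: v.
Proof.
move=> d_gt0 sA.
have [v vS vmax] : exists2 v, v \in sphere & forall w, w \in sphere -> qf A w <= qf A v.
  apply: compact_EVT_max; last 2 first.
  - exact: sphere_compact.
  - by apply: continuous_subspaceT; exact: qf_continuous.
  have n0 : (const_mx 1 : 'cV[R]_d) != 0.
    apply/eqP => /colP/(_ (Ordinal d_gt0)); rewrite !mxE => /eqP.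
    by rewrite oner_eq0.
  by have [c _ cS] := sphere_normalize n0; exists (c *: const_mx 1).
rewrite inE in vS; exists (qf A v).
have pm : psd ((qf A v)%:M - A).
  apply: psd_sphere => [|w wS].
    by apply: symB => //; rewrite -scalemx1; apply/symZ/sym1.
  by rewrite qfD qfN -scalemx1 qfZ wS mulr1 subr_ge0 vmax // inE.
split=> //; exists v => //.
have := psd_ker pm; move=> /(_ v); rewrite qfD qfN -scalemx1 qfZ vS mulr1 subrr.
by move=> /(_ erefl); rewrite mulmxBl -scalemxAl mul1mx => /eqP; rewrite subr_eq0 => /eqP.
Qed.

End Quadratic.

Section Frobenius.
Variables (R : realType) (p q : nat).
Implicit Types X Y : 'M[R]_(p, q).

Lemma trace_trmx_mulE X Y : \tr (X^T *m Y) = \sum_j \sum_i X i j * Y i j.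
Proof.
apply: eq_bigr => j _; rewrite mxE; apply: eq_bigr => i _; by rewrite mxE.
Qed.

Lemma trace_trmx_mulC X Y : \tr (X^T *m Y) = \tr (Y^T *m X).
Proof. by rewrite -mxtrace_tr trmx_mul trmxK. Qed.

Lemma normsq_ge0 X : 0 <= \tr (X^T *m X).
Proof.
rewrite trace_trmx_mulE; apply: sumr_ge0 => j _; apply: sumr_ge0 => i _.
by rewrite -expr2 sqr_ge0.
Qed.

Lemma normsq_eq0 X : \tr (X^T *m X) = 0 -> X = 0.
Proof.
rewrite trace_trmx_mulE => /eqP; rewrite psumr_eq0 => [/allP h|j _]; last first.
  by apply: sumr_ge0 => i _; rewrite -expr2 sqr_ge0.
apply/matrixP => i j; have := h j (mem_index_enum _).
rewrite psumr_eq0 => [/allP/(_ i (mem_index_enum _))|k _]; last by rewrite -expr2 sqr_ge0.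
by rewrite -expr2 sqrf_eq0 mxE => /eqP.
Qed.

Lemma frob_sqr X : frob X ^+ 2 = \tr (X^T *m X).
Proof. by rewrite sqr_sqrtr // normsq_ge0. Qed.

End Frobenius.

(** * The real spectral theorem *)

Section Spectral.
Variable R : realType.

Lemma orthC d (U : 'M[R]_d) : U *m U^T = 1%:M -> U^T *m U = 1%:M.
Proof. exact: mulmx1C. Qed.

(** For v != e, the reflection in the hyperplane orthogonal to v - e exchanges
    the unit vectors v and e. *)
Lemma householder d (v e : 'cV[R]_d) : sphere v -> sphere e ->
  exists U : 'M[R]_d, [/\ U^T = U, U *m U = 1%:M & U *m e = v].
Proof.
move=> v1 e1; have [->|ve] := eqVneq v e.
  by exists 1%:M; rewrite trmx1 !mul1mx.
set w := v - e; have w0 : w != 0 by rewrite subr_eq0.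
set N := qf 1%:M w; have N0 : N != 0 by rewrite gt_eqF // qf1_gt0.
have Nw : w^T *m w = N%:M by rewrite [LHS]mx11_scalar /N mulmx1.
have we : w^T *m e = (- (N / 2))%:M.
  rewrite [LHS]mx11_scalar; congr scalar_mx.
  have := qf_polar v e (-1) (sym1 R d); rewrite v1 e1 !mulmx1 scaleN1r -/w => h.
  rewrite /N mulmx1 h.
  have -> : (w^T *m e) 0 0 = (e^T *m v) 0 0 - 1.
    have -> : w^T *m e = (e^T *m v)^T - e^T *m e.
      by rewrite /w linearB /= mulmxBl trmx_mul trmxK.
    by rewrite !mxE; move: e1; rewrite /sphere /= mulmx1 mxE => ->.
  by field.
exists (1%:M - (2 / N) *: (w *m w^T)); split.
- by rewrite linearB /= trmx1 linearZ /= trmx_mul trmxK.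
- have : (w *m w^T) *m (w *m w^T) = N *: (w *m w^T).
    by rewrite mulmxA -(mulmxA w) Nw mul_mx_scalar -scalemxAl.
  move: (w *m w^T) => M MM.
  rewrite mulmxBl mul1mx -scalemxAl mulmxBr mulmx1 -scalemxAr MM.
  by apply/matrixP => i j; rewrite !mxE; field.
- rewrite mulmxBl mul1mx -scalemxAl -mulmxA we mul_mx_scalar scalerA.
  have -> : 2 / N * - (N / 2) = -1 by field.
  by rewrite scaleN1r opprK /w addrC subrK.
Qed.

(** Conjugation by a reflection that sends the first basis vector to a top
    eigenvector splits off a 1 x 1 block, and induction diagonalizes the rest. *)
Lemma spectral d (A : 'M[R]_d) : A \is symmetricmx ->
  exists (U : 'M[R]_d) (x : 'rV[R]_d),
    U *m U^T = 1%:M /\ A = U^T *m diag_mx x *m U.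
Proof.
elim: d A => [|d IHd] A sA.
  by exists 1%:M, 0; rewrite trmx1 mulmx1; split=> //; rewrite [RHS]flatmx0 flatmx0.
have [l [_ [v vS Av]]] := rayleigh_max (ltn0Sn d) sA.
pose e : 'cV[R]_(1 + d) := col_mx 1%:M 0.
have eS : sphere e.
  by rewrite /sphere /= mulmx1 tr_col_mx mul_row_col trmx1 mul1mx trmx0 mul0mx addr0 mxE.
have [U [sU UU Ue]] := householder (vS : @sphere R (1 + d) v) eS.
have sA1 : (A : 'M[R]_(1 + d)) \is symmetricmx by exact: sA.
pose B : 'M[R]_(1 + d) := U *m A *m U.
have sB : B \is symmetricmx by rewrite /B -{1}sU; exact: (sym_congr U sA1).
have Be : B *m e = l *: e.
  by rewrite /B -!mulmxA Ue Av -scalemxAr -Ue mulmxA UU mul1mx.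
have [ul dl] : ulsubmx B = l%:M /\ dlsubmx B = 0.
  move: Be; rewrite -{1}[B]submxK mul_block_col !mulmx1 !mulmx0 !addr0.
  by rewrite scale_col_mx scaler0 scalemx1 => /eq_col_mx.
have ur : ursubmx B = 0.
  by rewrite -[LHS]trmxK trmx_ursub (symmxP _ sB) dl trmx0.
have sB' : drsubmx B \is symmetricmx.
  by apply/symmxP; rewrite trmx_drsub (symmxP _ sB).
have BE : B = block_mx l%:M 0 0 (drsubmx B) by rewrite -{1}[B]submxK ul dl ur.
have [V [x [VV B'E]]] := IHd _ sB'.
pose W : 'M[R]_(1 + d) := block_mx 1%:M 0 0 V.
have WW : W *m W^T = 1%:M.
  rewrite /W tr_block_mx !trmx0 trmx1 mulmx_block VV.
  by rewrite !(mulmx0, mul0mx, addr0, add0r, mul1mx) -scalar_mx_block.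
exists (W *m U), (row_mx l%:M x); split.
  by rewrite trmx_mul sU mulmxA -(mulmxA W) UU mulmx1.
have BW : B = W^T *m diag_mx (row_mx l%:M x) *m W.
  rewrite BE B'E /W tr_block_mx !trmx0 trmx1 diag_mx_row !mulmx_block.
  rewrite !(mulmx0, mul0mx, addr0, add0r, mul1mx, mulmx1).
  by congr block_mx; apply/matrixP => i j; rewrite !ord1 !mxE.
have -> : A = U *m B *m U by rewrite /B -!mulmxA UU mulmx1 mulmxA UU mul1mx.
by rewrite BW trmx_mul sU !mulmxA.
Qed.

End Spectral.

(** * Matrix exponential, logarithm and square root *)

Local Notation spec U x := (U^T *m diag_mx x *m U).

Section Functional.
Variables (R : realType) (d : nat).
Implicit Types (A B E G H S Q X Z U W : 'M[R]_d) (u v w : 'cV[R]_d) (x y : 'rV[R]_d).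

Lemma spec_sym U x : spec U x \is symmetricmx.
Proof. by apply/sym_congr/symmxP; rewrite tr_diag_mx. Qed.

Lemma specM U x y : U *m U^T = 1%:M ->
  spec U x *m spec U y = spec U (\row_i (x 0 i * y 0 i)).
Proof.
move=> UU; rewrite !mulmxA -(mulmxA _ U) UU mulmx1 -(mulmxA _ (diag_mx x)).
by rewrite mulmx_diag.
Qed.

Lemma specZ U x a : a *: spec U x = spec U (a *: x).
Proof. by rewrite linearZ /= -scalemxAr -scalemxAl. Qed.

Lemma spec1 U : U *m U^T = 1%:M -> spec U (const_mx 1) = 1%:M.
Proof. by move=> UU; rewrite diag_const_mx mulmx1 orthC. Qed.

Lemma specK U x : U *m U^T = 1%:M -> U *m spec U x *m U^T = diag_mx x.
Proof. by move=> UU; rewrite !mulmxA UU mul1mx -mulmxA UU mulmx1. Qed.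

Lemma trace_spec Q U x : \tr (Q *m spec U x) = \sum_i (U *m Q *m U^T) i i * x 0 i.
Proof.
rewrite mulmxA mxtrace_mulC !mulmxA mul_mx_diag /mxtrace.
by apply: eq_bigr => i _; rewrite mxE.
Qed.

Lemma qf_delta A i : qf A (delta_mx i 0 : 'cV[R]_d) = A i i.
Proof. by rewrite trmx_delta -rowE -colE !mxE. Qed.

Lemma psd_diag_ge0 A i : psd A -> 0 <= A i i.
Proof. by move=> [_ pA]; rewrite -qf_delta. Qed.

Lemma psd_orth_diag_ge0 Q U i : psd Q -> 0 <= (U *m Q *m U^T) i i.
Proof. by move=> pQ; apply: psd_diag_ge0; rewrite -{1}[U]trmxK; exact: psd_congr. Qed.

Lemma psd_spec_ge0 U x i : U *m U^T = 1%:M -> psd (spec U x) -> 0 <= x 0 i.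
Proof.
move=> UU /(psd_orth_diag_ge0 U i); rewrite specK // mxE eqxx //.
Qed.

Lemma spd_spec_gt0 U x i : U *m U^T = 1%:M -> spd (spec U x) -> 0 < x 0 i.
Proof.
move=> UU sp.
have uU : U^T \in unitmx by rewrite unitmx_tr; case: (mulmx1_unit UU).
have [_ /(_ (delta_mx i 0 : 'cV[R]_d))] := spd_congr uU sp.
rewrite trmxK specK // qf_delta mxE eqxx mulr1n; apply.
by apply/eqP => /matrixP/(_ i 0); rewrite !mxE !eqxx => /eqP; rewrite oner_eq0.
Qed.

Lemma spec_spd U x : U *m U^T = 1%:M -> (forall i, 0 < x 0 i) -> spd (spec U x).
Proof.
move=> UU x0; apply: spd_congr; first by case: (mulmx1_unit UU).
split; first by apply/symmxP; rewrite tr_diag_mx.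
have qfd v : qf (diag_mx x) v = \sum_i x 0 i * v i 0 ^+ 2.
  rewrite mul_mx_diag mxE; apply: eq_bigr => i _; rewrite !mxE; ring.
move=> v v0; rewrite lt_def qfd sumr_ge0 ?andbT => [|i _]; last first.
  by rewrite mulr_ge0 ?sqr_ge0 // ltW.
rewrite psumr_eq0 => [|i _]; last by rewrite mulr_ge0 ?sqr_ge0 // ltW.
apply: contra v0 => /allP h; apply/eqP/colP => i; rewrite mxE.
have := h i (mem_index_enum _); rewrite mulf_eq0 gt_eqF //= sqrf_eq0.
by move/eqP.
Qed.

Lemma psd_trace_ge0 Q A : psd Q -> psd A -> 0 <= \tr (Q *m A).
Proof.
move=> pQ pA; have [U [x [UU AE]]] := spectral (psd_sym pA).
rewrite AE trace_spec; apply: sumr_ge0 => i _; rewrite mulr_ge0 //.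
  exact: psd_orth_diag_ge0.
by apply: (psd_spec_ge0 _ UU); rewrite -AE.
Qed.

(** With y = A^-1 v, nonnegativity of the form B at B^-1 v - y expands to
    v^T B^-1 v - 2 v^T y + y^T B y >= 0, where y^T B y <= y^T A y = v^T y. *)
Lemma inv_antitone A B : spd A -> spd B -> psd (A - B) ->
  psd (invmx B - invmx A).
Proof.
move=> sA sB [_ pAB]; have [hA hB] := (spd_sym sA, spd_sym sB).
split=> [|v]; first by apply: symB; exact: sym_inv.
pose y := invmx A *m v.
have yB : (y^T *m B *m (invmx B *m v)) 0 0 = qf (invmx A) v.
  rewrite -mulmxA mulKVmx ?spd_unit // /y trmx_mul (symmxP _ (sym_inv hA)) //.
have yA : qf A y = qf (invmx A) v.
  by rewrite -mulmxA mulKVmx ?spd_unit // /y trmx_mul (symmxP _ (sym_inv hA)).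
have vB : qf B (invmx B *m v) = qf (invmx B) v.
  by rewrite -mulmxA mulKVmx ?spd_unit // trmx_mul (symmxP _ (sym_inv hB)).
have := (spd_psd sB).2 (invmx B *m v + (-1) *: y).
have := pAB y; rewrite qf_polar // !qfD !qfN vB yB yA; lra.
Qed.

Lemma expm_spec U x : U *m U^T = 1%:M -> expm (spec U x) = spec U (map_mx expR x).
Proof. exact: funcalcE. Qed.

Lemma expm_spd Z : Z \is symmetricmx -> spd (expm Z).
Proof.
move=> /spectral[U [x [UU ->]]]; rewrite expm_spec //.
by apply: spec_spd => // i; rewrite mxE expR_gt0.
Qed.

Lemma expmD Z (s t : R) : Z \is symmetricmx ->
  expm (s *: Z) *m expm (t *: Z) = expm ((s + t) *: Z).
Proof.
move=> /spectral[U [x [UU ->]]]; rewrite !specZ !expm_spec // specM //.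
by congr (_ *m diag_mx _ *m _); apply/rowP => i; rewrite !mxE mulrDl expRD.
Qed.

Lemma expm0 : expm (0 : 'M[R]_d) = 1%:M.
Proof.
have -> : 0 = spec (1%:M : 'M[R]_d) 0 by rewrite linear0 mulmx0 mul0mx.
have UU : (1%:M : 'M[R]_d) *m 1%:M^T = 1%:M by rewrite trmx1 mulmx1.
rewrite expm_spec // -[RHS](spec1 UU); congr (_ *m diag_mx _ *m _).
by apply/rowP => i; rewrite !mxE expR0.
Qed.

Lemma expmN Z : Z \is symmetricmx -> expm (- Z) = invmx (expm Z).
Proof.
move=> sZ; have e1 : expm (- Z) *m expm Z = 1%:M.
  have := expmD (-1) 1 sZ.
  by rewrite addNr scale0r expm0 scale1r scaleN1r.
have [_ uZ] := mulmx1_unit e1.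
by rewrite -[LHS](mulmxK uZ) e1 mul1mx.
Qed.

(** Positive definite matrices are exponentials of symmetric ones; facts about
    square roots and inverses are derived below from this parametrization. *)
Lemma expm_logm E : spd E -> logm E \is symmetricmx /\ expm (logm E) = E.
Proof.
move=> sE; have [U [x [UU EE]]] := spectral (spd_sym sE).
have lE : logm E = spec U (map_mx (@ln R) x) by rewrite EE /logm funcalcE.
rewrite lE; split; first exact: spec_sym.
rewrite expm_spec // EE; congr (_ *m diag_mx _ *m _).
apply/rowP => i; rewrite !mxE lnK // posrE.
by apply: (spd_spec_gt0 _ UU); rewrite -EE.
Qed.

Lemma logm_conj_expm W Z : W *m W^T = 1%:M -> Z \is symmetricmx ->
  logm (W *m expm Z *m W^T) = W *m Z *m W^T.
Proof.
move=> WW /spectral[U [x [UU ->]]]; rewrite expm_spec //.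
have VV : (U *m W^T) *m (U *m W^T)^T = 1%:M.
  by rewrite trmx_mul trmxK mulmxA -(mulmxA U) orthC // mulmx1.
have cE y : W *m spec U y *m W^T = spec (U *m W^T) y.
  by rewrite trmx_mul trmxK !mulmxA.
rewrite !cE /logm funcalcE //; congr (_ *m diag_mx _ *m _).
by apply/rowP => i; rewrite !mxE expRK.
Qed.

Lemma sqrtm_expm Z : Z \is symmetricmx -> sqrtm (expm Z) = expm (2^-1 *: Z).
Proof.
move=> /spectral[U [x [UU ->]]]; rewrite specZ !expm_spec // /sqrtm funcalcE //.
congr (_ *m diag_mx _ *m _); apply/rowP => i; rewrite !mxE.
have -> : expR (x 0 i) = expR (2^-1 * x 0 i) ^+ 2.
  by rewrite expr2 -expRD; congr expR; field.
by rewrite sqrtr_sqr ger0_norm // expR_ge0.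
Qed.

Lemma sqrtm_spd (P : 'M[R]_d) : spd P -> spd (sqrtm P) /\ sqrtm P *m sqrtm P = P.
Proof.
move=> sP; have [sL eL] := expm_logm sP.
have -> : sqrtm P = expm (2^-1 *: logm P) by rewrite -{1}eL sqrtm_expm.
split; first exact/expm_spd/symZ.
by rewrite expmD // -[RHS]eL -[in RHS](scale1r (logm P)); congr (expm (_ *: _)); field.
Qed.

(** Jensen's inequality: in an eigenbasis of Z the diagonal of Q is
    a probability vector, and exp lies above its tangent at the mean tr (Q Z). *)
Lemma jensen_expm Q Z : psd Q -> \tr Q = 1 -> Z \is symmetricmx ->
  expR (\tr (Q *m Z)) <= \tr (Q *m expm Z).
Proof.
move=> pQ tQ /spectral[U [x [UU ->]]]; rewrite expm_spec // !trace_spec.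
set q := fun i => (U *m Q *m U^T) i i.
set c := \sum_i _.
have q1 : \sum_i q i = 1.
  by rewrite -tQ /q -[LHS]/(\tr _) mxtrace_mulC mulmxA orthC // mul1mx.
have -> : expR c = \sum_i q i * (expR c * (1 + (x 0 i - c))).
  under eq_bigr => i _.
    rewrite (_ : _ * _ = expR c * (q i * x 0 i) + expR c * (1 - c) * q i); last by ring.
    over.
  rewrite big_split /= -!mulr_sumr q1 -/c; ring.
apply: ler_sum => i _; rewrite [map_mx _ _ _ _]mxE ler_wpM2l //; first exact: psd_orth_diag_ge0.
have -> : expR (x 0 i) = expR c * expR (x 0 i - c) by rewrite -expRD; congr expR; ring.
rewrite ler_wpM2l ?expR_ge0 //.
exact: expR_ge1Dx.
Qed.

End Functional.

(** * Generalized eigenvalues and condition numbers *)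

Section GeneralizedEigenvalues.
Variables (R : realType) (d : nat).
Hypothesis d_gt0 : (0 < d)%N.
Implicit Types (A B E G H S Q X Z U W C P : 'M[R]_d) (u v w : 'cV[R]_d).

Lemma ln_mul_expR (y a : R) : 0 < y -> ln (y * expR a) = ln y + a.
Proof. by move=> y0; rewrite lnM ?posrE ?expR_gt0 // expRK. Qed.

Lemma ler_ln_mul_expR (x y a : R) : 0 < x -> 0 < y -> x <= y * expR a ->
  ln x <= ln y + a.
Proof. by move=> x0 y0 xy; rewrite -ln_mul_expR // ler_ln // posrE mulr_gt0 ?expR_gt0. Qed.

Lemma ler_mul_expR_ln (x y a : R) : 0 < y -> y * expR a <= x ->
  ln y + a <= ln x.
Proof.
move=> y0 yx; have ya : 0 < y * expR a by rewrite mulr_gt0 ?expR_gt0.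
by rewrite -ln_mul_expR // ler_ln // posrE // (lt_le_trans ya).
Qed.

Lemma gen_eigenvalues_congr C E S : C \is symmetricmx -> C \in unitmx ->
  gen_eigenvalues (C *m E *m C) (C *m S *m C) = gen_eigenvalues E S.
Proof.
move=> sC uC; apply/seteqP; split => l [v v0 Hv].
  exists (C *m v); last first.
    by apply: (can_inj (mulKmx uC)); rewrite -scalemxAr !mulmxA.
  by apply: contraNneq v0 => Cv0; rewrite -(mulKmx uC v) Cv0 mulmx0.
exists (invmx C *m v).
  apply: contraNneq v0 => Cv0; by rewrite -(mulKVmx uC v) Cv0 mulmx0.
by rewrite -!mulmxA mulKVmx // Hv -scalemxAr.
Qed.

Lemma whitenK P H : spd P -> sqrtm P *m whiten P H *m sqrtm P = H.
Proof.
move=> sP; have [sC _] := sqrtm_spd sP; have uC := spd_unit sC.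
by rewrite /whiten !mulmxA mulmxV // mul1mx mulmxKV.
Qed.

Lemma whiten_spd P H : spd P -> spd H -> spd (whiten P H).
Proof.
move=> sP sH; have [sC _] := sqrtm_spd sP; have uC := spd_unit sC.
rewrite /whiten -{1}(symmxP _ (sym_inv (spd_sym sC))); apply: spd_congr => //.
by rewrite unitmx_inv.
Qed.

(** Congruence by the square root of E reduces the pair (E, S) to an ordinary
    symmetric eigenvalue problem. *)
Lemma gen_max E S : spd E -> S \is symmetricmx ->
  exists l, psd (l *: E - S) /\ gen_eigenvalues E S l.
Proof.
move=> sE sS; have [sC CC] := sqrtm_spd sE; have uC := spd_unit sC.
have WK := whitenK S sE; have symC := symmxP _ (spd_sym sC).
have sW : whiten E S \is symmetricmx.
  by rewrite /whiten -{1}(symmxP _ (sym_inv (spd_sym sC))); exact: sym_congr.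
have [l [pl [v vS Wv]]] := rayleigh_max d_gt0 sW; exists l; split.
  have := psd_congr (sqrtm E) pl; rewrite symC mulmxBr mulmxBl WK.
  by rewrite mul_mx_scalar -scalemxAl CC.
have -> : gen_eigenvalues E S = gen_eigenvalues 1%:M (whiten E S).
  rewrite -(gen_eigenvalues_congr 1%:M (whiten E S) (spd_sym sC) uC) WK mulmx1 CC //.
exists v; last by rewrite mul1mx.
apply/eqP => v0; move: vS; rewrite /sphere /= v0 mulmx0 mxE => /eqP.
by rewrite eq_sym oner_eq0.
Qed.

Lemma gen_eigenvalue_le E S l a : spd E -> psd (l *: E - S) ->
  gen_eigenvalues E S a -> a <= l.
Proof.
move=> [_ pE] [_ pl] [v v0 Sv]; have := pl v.
have -> : qf (l *: E - S) v = (l - a) * qf E v.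
  rewrite qfD qfN qfZ mulrBl; congr (_ - _).
  by rewrite -mulmxA Sv -scalemxAr mulmxA mxE.
by rewrite pmulr_lge0 ?pE // subr_ge0.
Qed.

Lemma sup_gen E S : spd E -> S \is symmetricmx ->
  psd (sup (gen_eigenvalues E S) *: E - S) /\
  gen_eigenvalues E S (sup (gen_eigenvalues E S)).
Proof.
move=> sE sS; have [l [pl gl]] := gen_max sE sS.
suff -> : sup (gen_eigenvalues E S) = l by [].
apply/eqP; rewrite eq_le; apply/andP; split.
  by apply: ge_sup; [exists l|move=> a; exact: gen_eigenvalue_le].
by apply: ub_le_sup => //; exists l => a; exact: gen_eigenvalue_le.
Qed.

(** Reduces the smallest generalized eigenvalue to the largest one, for which
    the Rayleigh quotient argument was made. *)
Lemma inf_genE E S : inf (gen_eigenvalues E S) = - sup (gen_eigenvalues E (- S)).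
Proof.
rewrite /inf; congr (- sup _); apply/seteqP; split => [_ [l [v v0 Sv] <-]|l [v v0 Sv]].
  by exists v => //; rewrite mulNmx Sv scaleNr.
exists (- l); last by rewrite opprK.
by exists v => //; rewrite scaleNr -Sv mulNmx opprK.
Qed.

Lemma inf_gen E S : spd E -> S \is symmetricmx ->
  psd (S - inf (gen_eigenvalues E S) *: E) /\
  gen_eigenvalues E S (inf (gen_eigenvalues E S)).
Proof.
move=> sE sS; have [p [v v0 Sv]] := sup_gen sE (symN sS).
rewrite inf_genE; split; first by rewrite scaleNr opprK addrC -[X in _ + X]opprK.
by exists v => //; rewrite scaleNr -Sv mulNmx opprK.
Qed.

Lemma gen_eigenvalue_gt0 E S a : spd E -> spd S ->
  gen_eigenvalues E S a -> 0 < a.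
Proof.
move=> [_ pE] [_ pS] [v v0 Sv]; have := pS v v0.
by rewrite -mulmxA Sv -scalemxAr mulmxA mxE pmulr_lgt0 // pE.
Qed.

Lemma sup_gen_le E S l : spd E -> S \is symmetricmx -> psd (l *: E - S) ->
  sup (gen_eigenvalues E S) <= l.
Proof. by move=> sE sS pl; exact: gen_eigenvalue_le sE pl (sup_gen sE sS).2. Qed.

Lemma inf_gen_ge E S l : spd E -> S \is symmetricmx -> psd (S - l *: E) ->
  l <= inf (gen_eigenvalues E S).
Proof.
move=> sE sS pl; rewrite inf_genE lerNr; apply: sup_gen_le => //; first exact: symN.
by rewrite scaleNr opprK addrC.
Qed.

Lemma eigenvalue_gen S : S \is symmetricmx ->
  [set a | eigenvalue S a] = gen_eigenvalues 1%:M S.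
Proof.
move=> /symmxP sS; apply/seteqP; split => a /=.
  move=> /eigenvalueP[v Sv v0]; exists v^T; first by rewrite trmx_eq0.
  by rewrite mul1mx -{1}sS -trmx_mul Sv linearZ.
move=> [v v0]; rewrite mul1mx => Sv; apply/eigenvalueP; exists v^T; last by rewrite trmx_eq0.
by rewrite -{1}sS -trmx_mul Sv linearZ.
Qed.

Lemma lmaxP S : S \is symmetricmx ->
  psd ((lmax S)%:M - S) /\ gen_eigenvalues 1%:M S (lmax S).
Proof.
move=> sS; rewrite /lmax eigenvalue_gen // -[(sup _)%:M]scalemx1.
exact: sup_gen (spd1 _ _) sS.
Qed.

Lemma lminP S : S \is symmetricmx ->
  psd (S - (lmin S)%:M) /\ gen_eigenvalues 1%:M S (lmin S).
Proof.
move=> sS; rewrite /lmin eigenvalue_gen // -[(inf _)%:M]scalemx1.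
exact: inf_gen (spd1 _ _) sS.
Qed.

Lemma densities_mulmx S Q a : S \is symmetricmx -> densities S a Q ->
  Q *m S = a *: Q.
Proof.
move=> sS [_ _ /sub_kermxP]; rewrite mulmxBr mul_mx_scalar => /eqP.
by rewrite subr_eq0 => /eqP.
Qed.

Lemma ln_kappaE E S : spd E -> spd S ->
  ln (kappa E S) = ln (sup (gen_eigenvalues E S)) - ln (inf (gen_eigenvalues E S)).
Proof.
move=> sE sS; have sS' := spd_sym sS.
have [[_ gs] [_ gi]] := (sup_gen sE sS', inf_gen sE sS').
by rewrite /kappa ln_div // posrE; exact: gen_eigenvalue_gt0 (gs) || exact: gen_eigenvalue_gt0 gi.
Qed.

Lemma invmxZ_spd a A : 0 < a -> spd A -> invmx (a *: A) = a^-1 *: invmx A.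
Proof. by move=> a0 sA; rewrite invmxZ // spd_unit //; exact: spdZ. Qed.

(** With L the largest generalized eigenvalue, S <= L e^Z. Pairing this with Q
    would leave tr (Q e^Z), which Jensen bounds on the wrong side; inverting
    first gives e^(- Z) <= L S^-1, where tr (Q S^-1) = 1 / lmax S. *)
Lemma sup_gen_ge_density S Z Q : spd S -> Z \is symmetricmx ->
  densities S (lmax S) Q ->
  lmax S * expR (- \tr (Q *m Z)) <= sup (gen_eigenvalues (expm Z) S).
Proof.
move=> sS sZ DQ; have sS' := spd_sym sS; have sE := expm_spd sZ.
have QS := densities_mulmx sS' DQ; have [pQ tQ _] := DQ.
have [_ /(gen_eigenvalue_gt0 (spd1 _ _) sS) lm0] := lmaxP sS'.
have [p gs] := sup_gen sE sS'; set L := sup _ in p gs *.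
have L0 : 0 < L := gen_eigenvalue_gt0 sE sS gs.
have := psd_trace_ge0 pQ (inv_antitone (spdZ L0 sE) sS p).
rewrite mulmxBr linearB /= invmxZ_spd // -scalemxAr linearZ /= -expmN //.
have -> : \tr (Q *m invmx S) = (lmax S)^-1.
  rewrite -[Q](scalerK (a := lmax S)) ?gt_eqF // -QS -scalemxAl mulmxK ?spd_unit //.
  by rewrite linearZ /= tQ mulr1.
rewrite subr_ge0 => h; have sN : - Z \is symmetricmx by exact: symN.
have := jensen_expm pQ tQ sN; rewrite mulmxN linearN /= => j.
rewrite -ler_pdivlMl // mulrC; move: h; rewrite ler_pdivrMl // => h.
exact: le_trans j h.
Qed.

(** Here Jensen has the right direction, and the inequality L e^Z <= S for the
    smallest generalized eigenvalue L is paired with Q as it stands. *)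
Lemma inf_gen_le_density S Z Q : spd S -> Z \is symmetricmx ->
  densities S (lmin S) Q ->
  inf (gen_eigenvalues (expm Z) S) <= lmin S * expR (- \tr (Q *m Z)).
Proof.
move=> sS sZ DQ; have sS' := spd_sym sS; have sE := expm_spd sZ.
have QS := densities_mulmx sS' DQ; have [pQ tQ _] := DQ.
have [p gs] := inf_gen sE sS'; set L := inf _ in p gs *.
have L0 : 0 < L := gen_eigenvalue_gt0 sE sS gs.
have := psd_trace_ge0 pQ p.
rewrite mulmxBr linearB /= QS linearZ /= tQ mulr1 -scalemxAr linearZ /= subr_ge0.
have := jensen_expm pQ tQ sZ; rewrite expRN -ler_pdivrMr ?invr_gt0 ?expR_gt0 // invrK.
by move=> j; apply: le_trans; rewrite ler_wpM2l // ltW.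
Qed.

(** The matrices Q- - Q+ are subgradients at 0 of the logarithmic condition
    number of the pair (e^Z, S) as a function of Z. *)
Lemma ln_kappa_ge S Z Qp Qm : spd S -> Z \is symmetricmx ->
  densities S (lmax S) Qp -> densities S (lmin S) Qm ->
  ln (lmax S / lmin S) + \tr ((Qm - Qp) *m Z) <= ln (kappa (expm Z) S).
Proof.
move=> sS sZ Dp Dm; have sS' := spd_sym sS; have sE := expm_spd sZ.
have [_ /(gen_eigenvalue_gt0 (spd1 _ _) sS) lp0] := lmaxP sS'.
have [_ /(gen_eigenvalue_gt0 (spd1 _ _) sS) lm0] := lminP sS'.
have [_ /(gen_eigenvalue_gt0 sE sS) L0] := sup_gen sE sS'.
have [_ /(gen_eigenvalue_gt0 sE sS) l0] := inf_gen sE sS'.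
rewrite ln_kappaE // ln_div ?posrE // mulmxBl linearB /=.
have /(ler_mul_expR_ln lp0) h1 := sup_gen_ge_density sS sZ Dp.
have /(ler_ln_mul_expR l0 lm0) h2 := inf_gen_le_density sS sZ Dm.
move: h1 h2; lra.
Qed.

(** Let v be a unit vector. If v^T g v < c, Jensen's inequality
    v^T e^(- t g) v >= exp (- t v^T g v) already gives the bound for every
    t > 0. The unit vectors with v^T g v >= c form a compact set without
    eigenvectors for l, so v^T (l - S) v has a positive minimum there, and this
    gap absorbs the first-order error once t is small. *)
Lemma loewner_perturb S g (l c : R) : 0 < l -> psd (l%:M - S) ->
  S \is symmetricmx -> g \is symmetricmx ->
  (forall v, sphere v -> S *m v = l *: v -> qf g v < c) ->
  exists2 t0, 0 < t0 &
    forall t, 0 < t < t0 -> psd ((l * expR (t * c)) *: expm (- t *: g) - S).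
Proof.
move=> l0 pl sS sg gc.
have [m [[_ pm] _]] := rayleigh_max d_gt0 sg.
have [del del0 hdel] : exists2 del, 0 < del &
    forall v, sphere v -> c <= qf g v -> del <= qf (l%:M - S) v.
  pose K := @sphere R d `&` [set v | c <= qf g v].
  have [/set0P K0|/negP] := boolP (K != set0); last first.
    move=> /negP; rewrite negbK => /eqP K0; exists 1 => // v vS cv.
    by have : K v by []; rewrite K0.
  have cK : compact K.
    apply: compact_closedI; first exact: sphere_compact.
    apply: (@preimage_closed _ _ (fun v => qf g v) [set x | c <= x]); last exact: closed_ge.
    by move=> v _; exact: qf_continuous.
  have [|v0] := compact_EVT_min (f := fun v => qf (l%:M - S) v) K0 cK.
    by apply: continuous_subspaceT; exact: qf_continuous.
  rewrite inE => -[v0S cv0] vmin; exists (qf (l%:M - S) v0).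
    rewrite lt_def pl.2 andbT; apply/negP => /eqP /(psd_ker pl).
    rewrite mulmxBl mul_scalar_mx => /eqP; rewrite subr_eq0 eq_sym => /eqP Sv0.
    by have := gc _ v0S Sv0; rewrite ltNge cv0.
  by move=> v vS cv; apply: vmin; rewrite inE.
have D0 : 0 < l * (`|m - c| + 1) by rewrite mulr_gt0 // ltr_wpDl.
(* m - c bounds the excess of the g-form over c; the added 1 avoids dividing
   by zero *)
exists (del / (l * (`|m - c| + 1))); first by rewrite divr_gt0.
move=> t /andP[t0 tt0]; have st : - t *: g \is symmetricmx by exact: symZ.
apply: psd_sphere => [|v vS].
  by apply: symB => //; apply/symZ/spd_sym/expm_spd.
have v1 : \tr (v *m v^T) = 1.
  by move: vS; rewrite /sphere /= qf_trace mulmx1.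
have := jensen_expm (psd_outer v) v1 st; rewrite -!qf_trace => j.
rewrite qfD qfN qfZ subr_ge0.
apply: (@le_trans _ _ (l * expR (t * (c - qf g v)))); last first.
  rewrite -mulrA ler_wpM2l ?(ltW l0) // mulrBr expRD ler_wpM2l ?expR_ge0 //.
  by move: j; rewrite qfZ mulNr.
have lS : qf (l%:M - S) v = l - qf S v.
  by rewrite qfD qfN -scalemx1 qfZ vS mulr1.
have [cv|cv] := leP c (qf g v); last first.
  have := pl.2 v; rewrite lS subr_ge0 => /le_trans; apply.
  rewrite ler_peMr ?(ltW l0) // -[1]expR0 ler_expR mulr_ge0 ?(ltW t0) //.
  by rewrite subr_ge0 ltW.
have := hdel v vS cv; rewrite lS => hd.
have gm : qf g v <= m.
  by have := pm v; rewrite qfD qfN -scalemx1 qfZ vS mulr1 subr_ge0.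
apply: (@le_trans _ _ (l * (1 + t * (c - qf g v)))); last first.
  by rewrite ler_wpM2l ?(ltW l0) // expR_ge1Dx.
suff : l * (t * (qf g v - c)) <= del by move: hd; nra.
move: tt0; rewrite ltr_pdivlMr // => tt0.
apply: le_trans (ltW tt0); rewrite mulrCA ler_wpM2l ?(ltW t0) // ler_wpM2l ?(ltW l0) //.
by have := ler_norm (m - c); lra.
Qed.

(** The largest eigenvalue is handled by loewner_perturb; the smallest one is the
    inverse of the largest eigenvalue of S^-1 perturbed in the direction - g,
    because Jensen's inequality goes the wrong way when applied to S itself. *)
Lemma ln_kappa_le S g (cp cm : R) : spd S -> g \is symmetricmx ->
  (forall v, sphere v -> S *m v = lmax S *: v -> qf g v < cp) ->
  (forall v, sphere v -> S *m v = lmin S *: v -> - qf g v < cm) ->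
  exists2 t0, 0 < t0 & forall t, 0 < t < t0 ->
    ln (kappa (expm (- t *: g)) S) <= ln (lmax S / lmin S) + t * (cp + cm).
Proof.
move=> sS sg hp hm; have sS' := spd_sym sS.
have [pp /(gen_eigenvalue_gt0 (spd1 _ _) sS) lp0] := lmaxP sS'.
have [pm /(gen_eigenvalue_gt0 (spd1 _ _) sS) lm0] := lminP sS'.
have [t1 t10 ht1] := loewner_perturb lp0 pp sS' sg hp.
have lm0' : 0 < (lmin S)^-1 by rewrite invr_gt0.
have pm' : psd ((lmin S)^-1%:M - invmx S).
  have h : spd ((lmin S)%:M : 'M[R]_d) by rewrite -scalemx1; exact: spdZ (spd1 _ _).
  by have := inv_antitone sS h pm; rewrite invmx_scalar.
have hm' v : sphere v -> invmx S *m v = (lmin S)^-1 *: v -> qf (- g) v < cm.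
  move=> vS Sv; rewrite qfN; apply: hm => //.
  rewrite -[v in RHS](mulKVmx (spd_unit sS)) Sv -scalemxAr scalerA mulfV ?gt_eqF //.
  by rewrite scale1r.
have [t2 t20 ht2] := loewner_perturb lm0' pm' (sym_inv sS') (symN sg) hm'.
exists (Num.min t1 t2); first by rewrite lt_min t10.
move=> t /andP[t0]; rewrite lt_min => /andP[tt1 tt2].
have st : - t *: g \is symmetricmx by exact: symZ.
have sE := expm_spd st.
have [_ /(gen_eigenvalue_gt0 sE sS) L0] := sup_gen sE sS'.
have [_ /(gen_eigenvalue_gt0 sE sS) l0] := inf_gen sE sS'.
rewrite ln_kappaE // ln_div ?posrE //.
have h1 : sup (gen_eigenvalues (expm (- t *: g)) S) <= lmax S * expR (t * cp).
  by apply: sup_gen_le => //; apply: ht1; rewrite t0.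
have h2 : lmin S * expR (- (t * cm)) <= inf (gen_eigenvalues (expm (- t *: g)) S).
  apply: inf_gen_ge => //.
  have a0 : 0 < (lmin S)^-1 * expR (t * cm) by rewrite mulr_gt0 ?expR_gt0.
  have sE' : spd (expm (- t *: - g)) by apply/expm_spd/symZ/symN.
  have := inv_antitone (spdZ a0 sE') (spd_inv sS) (ht2 t _).
  rewrite invmxK invmxZ_spd // -expmN; last exact/symZ/symN.
  rewrite invfM invrK expRN scalerN opprK scaleNr; apply.
  by rewrite t0.
have := ler_ln_mul_expR L0 lp0 h1; have := ler_mul_expR_ln lm0 h2; lra.
Qed.

End GeneralizedEigenvalues.

(** * Kronecker products and the projection onto the log-Kronecker subspace *)

Section Kron.
Variables (R : realType) (m n : nat).
Implicit Types (X A : 'M[R]_m) (Y B : 'M[R]_n) (Z G M W : 'M[R]_(n * m)).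

Lemma tens1 : (1%:M : 'M[R]_n) *t (1%:M : 'M[R]_m) = 1%:M.
Proof.
apply/matrixP => i j; case: (mxtens_indexP i) => i1 i2; case: (mxtens_indexP j) => j1 j2.
rewrite tensmxE !mxE (can_eq (@mxtens_indexK _ _)) xpair_eqE.
by case: (i1 == j1); case: (i2 == j2); rewrite ?mulr1 ?mulr0 ?mul0r.
Qed.

Lemma tensDl B1 B2 A : (B1 + B2) *t A = B1 *t A + B2 *t A.
Proof. by apply/matrixP => i j; rewrite !mxE mulrDl. Qed.

Lemma tensDr B A1 A2 : B *t (A1 + A2) = B *t A1 + B *t A2.
Proof. by apply/matrixP => i j; rewrite !mxE mulrDr. Qed.

Lemma tensZl a B A : (a *: B) *t A = a *: (B *t A).
Proof. by apply/matrixP => i j; rewrite !mxE mulrA. Qed.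

Lemma tensZr a B A : B *t (a *: A) = a *: (B *t A).
Proof. by apply/matrixP => i j; rewrite !mxE mulrCA. Qed.

Definition kron_sum X Y : 'M[R]_(n * m) := (1%:M : 'M[R]_n) *t X + Y *t (1%:M : 'M[R]_m).

(** Eigenbases U of X and V of Y give the eigenbasis V *t U of the Kronecker sum,
    with eigenvalues y_i + x_k; exponentials of sums are products. *)
Lemma expm_kron_sum X Y : X \is symmetricmx -> Y \is symmetricmx ->
  expm (kron_sum X Y) = expm Y *t expm X.
Proof.
move=> /spectral[U [x [UU ->]]] /spectral[V [y [VV ->]]].
pose W := V *t U.
have WW : W *m W^T = 1%:M by rewrite /W trmx_tens tensmx_mul UU VV tens1.
have tens_spec (a : 'M[R]_n) (b : 'M[R]_m) :
    W^T *m (a *t b) *m W = (V^T *m a *m V) *t (U^T *m b *m U).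
  by rewrite /W trmx_tens !tensmx_mul.
have tens_diag (a : 'rV[R]_n) (b : 'rV[R]_m) :
    diag_mx a *t diag_mx b = diag_mx (\row_k (a 0 (mxtens_unindex k).1 * b 0 (mxtens_unindex k).2)).
  apply/matrixP => i j; case: (mxtens_indexP i) => i1 i2; case: (mxtens_indexP j) => j1 j2.
  rewrite tensmxE !mxE (can_eq (@mxtens_indexK _ _)) xpair_eqE mxtens_indexK /=.
  by case: (i1 == j1); case: (i2 == j2); rewrite ?mulr1n ?mulr0n ?mulr0 ?mul0r.
have -> : kron_sum (spec U x) (spec V y) =
    spec W (\row_k (y 0 (mxtens_unindex k).1 + x 0 (mxtens_unindex k).2)).
  rewrite /kron_sum -(spec1 UU) -(spec1 VV) -!tens_spec !tens_diag.
  rewrite -mulmxDl -mulmxDr -linearD /=; congr (_ *m diag_mx _ *m _).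
  by apply/rowP => k; rewrite !mxE mulr1 mul1r addrC.
rewrite !expm_spec // -tens_spec tens_diag; congr (_ *m diag_mx _ *m _).
by apply/rowP => k; rewrite !mxE expRD.
Qed.

Lemma log_kron_kron_sum X Y : X \is symmetricmx -> Y \is symmetricmx ->
  log_kron (kron_sum X Y).
Proof. by move=> sX sY; exists X, Y. Qed.

Lemma log_kron_sym Z : log_kron Z -> Z \is symmetricmx.
Proof.
move=> [X [Y [/symmxP sX /symmxP sY ->]]]; apply/symmxP.
by rewrite linearD /= !trmx_tens !trmx1 sX sY.
Qed.

Lemma log_kronZ a Z : log_kron Z -> log_kron (a *: Z).
Proof.
move=> [X [Y [sX sY ->]]]; exists (a *: X), (a *: Y).
by split; rewrite ?symZ // tensZr tensZl scalerDr.
Qed.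

Lemma log_kronD Z W : log_kron Z -> log_kron W -> log_kron (Z + W).
Proof.
move=> [X [Y [sX sY ->]]] [X' [Y' [sX' sY' ->]]]; exists (X + X'), (Y + Y').
by split; rewrite ?symD // tensDr tensDl addrACA.
Qed.

Lemma kron_expm Z : log_kron Z -> kron_family (expm Z).
Proof.
move=> [X [Y [sX sY ->]]]; exists (expm X), (expm Y).
by split; [exact: expm_spd|exact: expm_spd|rewrite -expm_kron_sum].
Qed.

Lemma kron_exists_log G : kron_family G -> exists2 Z, log_kron Z & G = expm Z.
Proof.
move=> [A [B [/expm_logm[sX eX] /expm_logm[sY eY] ->]]].
exists (kron_sum (logm A) (logm B)); first exact: log_kron_kron_sum.
by rewrite expm_kron_sum // eX eY.
Qed.

Lemma kron_spd G : kron_family G -> spd G.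
Proof. by move=> /kron_exists_log[Z lZ ->]; exact/expm_spd/log_kron_sym. Qed.

Lemma kron_sqrtm G : kron_family G -> kron_family (sqrtm G).
Proof.
move=> /kron_exists_log[Z lZ ->]; rewrite sqrtm_expm; last exact: log_kron_sym.
exact/kron_expm/log_kronZ.
Qed.

Lemma kron_invmx G : kron_family G -> kron_family (invmx G).
Proof.
move=> /kron_exists_log[Z lZ ->]; rewrite -expmN; last exact: log_kron_sym.
by rewrite -scaleN1r; exact/kron_expm/log_kronZ.
Qed.

Lemma kron_congr C G : kron_family C -> kron_family G ->
  kron_family (C *m G *m C).
Proof.
move=> [A [B [sA sB ->]]] [A' [B' [sA' sB' ->]]].
exists (A *m A' *m A), (B *m B' *m B); rewrite !tensmx_mul; split=> //.
  rewrite -{1}(symmxP _ (spd_sym sA)); exact: spd_congr (spd_unit sA) sA'.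
rewrite -{1}(symmxP _ (spd_sym sB)); exact: spd_congr (spd_unit sB) sB'.
Qed.

End Kron.

Section Projection.
Variables (R : realType) (m n : nat).
Hypotheses (m0 : (0 < m)%N) (n0 : (0 < n)%N).
Implicit Types (X A : 'M[R]_m) (Y B : 'M[R]_n) (Z G M W : 'M[R]_(n * m)).

(** Partial trace over the first tensor factor. *)
Definition ptrace1 M : 'M[R]_m :=
  \matrix_(k, l) \sum_i M (mxtens_index (i, k)) (mxtens_index (i, l)).
(** Partial trace over the second tensor factor. *)
Definition ptrace2 M : 'M[R]_n :=
  \matrix_(i, j) \sum_k M (mxtens_index (i, k)) (mxtens_index (j, k)).

Lemma sum_mxtens (F : 'I_(n * m) -> R) :
  \sum_k F k = \sum_i \sum_j F (mxtens_index (i, j)).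
Proof.
rewrite pair_big /= (reindex (@mxtens_index n m)) /=.
  by apply: eq_bigr => -[].
by exists (@mxtens_unindex n m) => k _; rewrite (mxtens_indexK, mxtens_unindexK).
Qed.

(** Partial trace is adjoint to X |-> 1 *t X for the trace form. *)
Lemma trace_tens1l X M : \tr ((1%:M *t X) *m M) = \tr (X *m ptrace1 M).
Proof.
rewrite /mxtrace sum_mxtens exchange_big /=; apply: eq_bigr => k _.
rewrite mxE.
under eq_bigr => i _.
  rewrite mxE sum_mxtens (bigD1 i) //= [X in _ + X]big1 ?addr0 => [|j ji].
    under eq_bigr do rewrite tensmxE mxE eqxx mul1r.
    over.
  by rewrite big1 // => l _; rewrite tensmxE mxE eq_sym (negbTE ji) !mul0r.
rewrite exchange_big /=; apply: eq_bigr => l _.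
by rewrite mxE mulr_sumr.
Qed.

Lemma trace_tens1r Y M : \tr ((Y *t 1%:M) *m M) = \tr (Y *m ptrace2 M).
Proof.
rewrite /mxtrace sum_mxtens; apply: eq_bigr => i _.
rewrite mxE.
under eq_bigr => k _.
  rewrite mxE sum_mxtens.
  under eq_bigr => j _.
    rewrite (bigD1 k) //= [X in _ + X]big1 ?addr0 => [|l lk]; last first.
      by rewrite tensmxE mxE eq_sym (negbTE lk) mulr0 mul0r.
    rewrite tensmxE mxE eqxx mulr1.
    over.
  over.
rewrite exchange_big /=; apply: eq_bigr => j _.
by rewrite mxE mulr_sumr.
Qed.

Lemma ptrace1_tens B A : ptrace1 (B *t A) = \tr B *: A.
Proof.
apply/matrixP => k l; rewrite !mxE mulr_suml; apply: eq_bigr => i _.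
by rewrite tensmxE.
Qed.

Lemma ptrace2_tens B A : ptrace2 (B *t A) = \tr A *: B.
Proof.
apply/matrixP => i j; rewrite !mxE mulr_suml; apply: eq_bigr => k _.
by rewrite tensmxE mulrC.
Qed.

Lemma trace_ptrace1 M : \tr (ptrace1 M) = \tr M.
Proof. by rewrite -[ptrace1 M]mul1mx -trace_tens1l tens1 mul1mx. Qed.

Lemma trace_ptrace2 M : \tr (ptrace2 M) = \tr M.
Proof. by rewrite -[ptrace2 M]mul1mx -trace_tens1r tens1 mul1mx. Qed.

Lemma ptrace1_linear : linear ptrace1.
Proof.
move=> a M N; apply/matrixP => k l; rewrite !mxE mulr_sumr -big_split /=.
by apply: eq_bigr => i _; rewrite !mxE.
Qed.

Lemma ptrace2_linear : linear ptrace2.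
Proof.
move=> a M N; apply/matrixP => k l; rewrite !mxE mulr_sumr -big_split /=.
by apply: eq_bigr => i _; rewrite !mxE.
Qed.

HB.instance Definition _ := GRing.isLinear.Build _ _ _ _ ptrace1 ptrace1_linear.
HB.instance Definition _ := GRing.isLinear.Build _ _ _ _ ptrace2 ptrace2_linear.

(** The adjoint maps determine the two components up to multiples of the
    identity; scalar matrices are counted in both partial traces, hence the
    correction by the normalized trace. *)
Definition log_kron_pr M : 'M[R]_(n * m) :=
  kron_sum (n%:R^-1 *: ptrace1 M)
       (m%:R^-1 *: ptrace2 M - (\tr M / (n%:R * m%:R)) *: 1%:M).

Lemma ptrace1_sym M : M \is symmetricmx -> ptrace1 M \is symmetricmx.
Proof.
move=> /symmxP sM; apply/symmxP/matrixP => k l; rewrite !mxE.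
by apply: eq_bigr => i _; rewrite -[in LHS]sM mxE.
Qed.

Lemma ptrace2_sym M : M \is symmetricmx -> ptrace2 M \is symmetricmx.
Proof.
move=> /symmxP sM; apply/symmxP/matrixP => k l; rewrite !mxE.
by apply: eq_bigr => i _; rewrite -[in LHS]sM mxE.
Qed.

Lemma log_kron_pr_in M : M \is symmetricmx -> log_kron (log_kron_pr M).
Proof.
move=> sM; apply: log_kron_kron_sum; first exact/symZ/ptrace1_sym.
by apply: symB; apply: symZ; [exact: ptrace2_sym|exact: sym1].
Qed.

Lemma log_kron_pr_orth M W : log_kron W -> \tr (W^T *m (M - log_kron_pr M)) = 0.
Proof.
move=> lW; rewrite (symmxP _ (log_kron_sym lW)).
have nz : n%:R != 0 :> R by rewrite pnatr_eq0 -lt0n.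
have mz : m%:R != 0 :> R by rewrite pnatr_eq0 -lt0n.
case: lW => X [Y [_ _ ->]].
rewrite mulmxDl linearD /= trace_tens1l trace_tens1r !linearB /= /log_kron_pr /kron_sum.
rewrite !linearD /= !ptrace1_tens !ptrace2_tens !mxtraceZ.
rewrite linearB /= !mxtraceZ !mxtrace1 trace_ptrace1 trace_ptrace2.
rewrite scalerBr !scalerA !mulfV // !scale1r mulmxBr -!scalemxAr !mulmx1.
rewrite [\tr (_ - _)]linearB /= !mxtraceZ.
by field; rewrite nz mz.
Qed.

Lemma proj_log_kronE M : M \is symmetricmx -> proj_log_kron M = log_kron_pr M.
Proof.
move=> sM; rewrite /proj_log_kron /orth_proj; set P := [set Z | _].
have : P (xget 0 P) by apply: (xgetPex 0); exists (log_kron_pr M);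
  split; [exact: log_kron_pr_in|move=> W; exact: log_kron_pr_orth].
move: (xget _ _) => Z [lZ oZ].
pose D := Z - log_kron_pr M.
have lD : log_kron D.
  by apply: log_kronD => //; rewrite -scaleN1r; apply/log_kronZ/log_kron_pr_in.
have : \tr (D^T *m D) = 0.
  have {2}-> : D = (M - log_kron_pr M) - (M - Z) by rewrite /D opprB [RHS]addrC addrA subrK.
  by rewrite -/D mulmxBr linearB /= log_kron_pr_orth // oZ // subr0.
by move=> /normsq_eq0 /eqP; rewrite subr_eq0 => /eqP.
Qed.

End Projection.

(** * Elements of minimum norm and density matrices *)

Section MinimumNorm.
Variables (R : realType) (p q : nat).
Implicit Types (K : set 'M[R]_(p, q)) (X Y g : 'M[R]_(p, q)).

Lemma ler_frob X Y : (frob X <= frob Y) = (\tr (X^T *m X) <= \tr (Y^T *m Y)).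
Proof. by rewrite ler_sqrt // normsq_ge0. Qed.

Lemma normsq_polar X Y (s : R) : \tr ((X + s *: Y)^T *m (X + s *: Y)) =
  \tr (X^T *m X) + s * \tr (X^T *m Y) *+ 2 + s ^+ 2 * \tr (Y^T *m Y).
Proof.
rewrite mulmxDr -scalemxAr [(X + _)^T]linearD /= [(_ *: Y)^T]linearZ /=.
rewrite !mulmxDl -!scalemxAl.
rewrite !linearD !linearZ /= (trace_trmx_mulC Y X); ring.
Qed.

(** Convexity with a bare real parameter, so that it can be instantiated by
    computed quotients such as a / (a + b). *)
Definition segment_closed K := forall X Y (s : R), K X -> K Y -> 0 <= s <= 1 ->
  K (s *: X + (1 - s) *: Y).

(** If <X, g> < |g|^2, a step of relative length s from g towards X changes the
    squared norm by - 2 s a + s^2 b with a > 0; the choice s = a / (a + b) makes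
    this negative and stays in the segment. *)
Lemma min_norm_variational K g X : segment_closed K ->
  argmin K (@frob R p q) g -> K X -> \tr (g^T *m g) <= \tr (X^T *m g).
Proof.
move=> cK [Kg gmin] KX; rewrite (trace_trmx_mulC X) leNgt; apply/negP => lt.
pose D := X - g.
have gD : \tr (g^T *m D) = \tr (g^T *m X) - \tr (g^T *m g) by rewrite mulmxBr linearB.
set a := \tr (g^T *m g) - \tr (g^T *m X); have a0 : 0 < a by rewrite subr_gt0.
set b := \tr (D^T *m D); have b0 : 0 <= b := normsq_ge0 D.
have ab : 0 < a + b by rewrite ltr_wpDr.
pose s := a / (a + b).
have s0 : 0 < s by rewrite divr_gt0.
have s1 : s <= 1 by rewrite ler_pdivrMr // mul1r lerDl.
have := gmin _ (cK _ _ s KX Kg _).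
rewrite (ltW s0) s1 => /(_ isT).
have -> : s *: X + (1 - s) *: g = g + s *: D.
  by rewrite /D scalerBr scalerBl scale1r addrC addrAC addrA.
rewrite ler_frob normsq_polar gD -/b.
have -> : \tr (g^T *m X) - \tr (g^T *m g) = - a by rewrite opprB.
have sab : s * (a + b) = a by rewrite divfK // gt_eqF.
have : s * b <= a by rewrite -sab ler_wpM2l ?(ltW s0) // lerDr ltW.
have sa : 0 < s * a by rewrite mulr_gt0.
rewrite expr2 -mulrA => sb; have : s * (s * b) <= s * a by rewrite ler_wpM2l // ltW.
lra.
Qed.

Lemma min_norm_unique K g g' : segment_closed K ->
  argmin K (@frob R p q) g -> argmin K (@frob R p q) g' -> g = g'.
Proof.
move=> cK mg mg'; have [Kg hg] := mg; have [Kg' hg'] := mg'.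
have v := min_norm_variational cK mg Kg'.
have := hg' _ Kg; rewrite ler_frob => le.
apply/eqP; rewrite -subr_eq0; apply/eqP/normsq_eq0/eqP.
rewrite eq_le normsq_ge0 andbT.
have := normsq_polar g' g (-1); rewrite scaleN1r -(opprB g g').
rewrite [(- _)^T]linearN /= mulNmx mulmxN opprK => ->.
move: v le; lra.
Qed.

Lemma frob_continuous : continuous (@frob R p q).
Proof.
have cn : continuous (fun X : 'M[R]_(p, q) => \tr (X^T *m X)).
  under eq_fun do rewrite trace_trmx_mulE.
  apply: continuous_sum => j; apply: continuous_sum => i X.
  have Xi := @coord_continuous R p q i j X.
  exact: (cvgM Xi Xi).
move=> X; exact: continuous_comp (cn X) (@sqrt_continuous R _).
Qed.

Lemma min_norm_exists K : compact K -> K !=set0 ->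
  exists g, argmin K (@frob R p q) g.
Proof.
move=> cK K0; have [|g gK gmin] := compact_EVT_min (f := @frob R p q) K0 cK.
  apply: continuous_subspaceT; exact: frob_continuous.
by rewrite inE in gK; exists g; split=> // X KX; apply: gmin; rewrite inE.
Qed.

End MinimumNorm.

Section Densities.
Variables (R : realType) (d : nat).
Implicit Types (A S Q : 'M[R]_d) (u v w : 'cV[R]_d).

Lemma densitiesE S a Q : densities S a Q <->
  [/\ psd Q, \tr Q = 1 & Q *m (S - a%:M) = 0].
Proof. by split=> -[? ? /sub_kermxP]. Qed.

Lemma densities_convex S a : segment_closed (densities S a).
Proof.
move=> X Y s /densitiesE[pX tX eX] /densitiesE[pY tY eY] /andP[s0 s1].
apply/densitiesE; split.
- by apply: psdD; apply: psdZ => //; rewrite subr_ge0.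
- by rewrite linearD !linearZ /= tX tY; ring.
- by rewrite mulmxDl -!scalemxAl eX eY !scaler0 addr0.
Qed.

Lemma outer_density S a v : S \is symmetricmx -> sphere v -> S *m v = a *: v ->
  densities S a (v *m v^T).
Proof.
move=> /symmxP sS vS Sv; apply/densitiesE; split; first exact: psd_outer.
  by move: vS; rewrite /sphere /= qf_trace mulmx1.
rewrite -mulmxA (_ : v^T *m (S - a%:M) = 0) ?mulmx0 //.
rewrite mulmxBr mul_mx_scalar -{1}sS -trmx_mul Sv linearZ /= subrr //.
Qed.

Lemma densities_nonempty S a : S \is symmetricmx ->
  gen_eigenvalues 1%:M S a -> densities S a !=set0.
Proof.
move=> sS [v v0]; rewrite mul1mx => Sv; have [c c0 cS] := sphere_normalize v0.
exists ((c *: v) *m (c *: v)^T); apply: outer_density => //.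
by rewrite -scalemxAr Sv !scalerA mulrC.
Qed.

(** The nonnegative diagonal entries sum to 1, and the form at e_i + e_j and
    e_i - e_j controls the off-diagonal ones. *)
Lemma density_entry_le1 Q i j : psd Q -> \tr Q = 1 -> `|Q i j| <= 1.
Proof.
move=> pQ tQ; have diag_le1 k : Q k k <= 1.
  rewrite -tQ /mxtrace (bigD1 k) //= lerDl; apply: sumr_ge0 => l _.
  exact: psd_diag_ge0.
have e : ((delta_mx j 0 : 'cV[R]_d)^T *m Q *m (delta_mx i 0 : 'cV[R]_d)) 0 0 = Q i j.
  by rewrite trmx_delta -rowE -colE !mxE -[in RHS](symmxP _ pQ.1) mxE.
have h (t : R) : 0 <= Q i i + t * Q i j *+ 2 + t ^+ 2 * Q j j.
  have := pQ.2 ((delta_mx i 0 : 'cV[R]_d) + t *: delta_mx j 0).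
  by rewrite (qf_polar _ _ _ pQ.1) !qf_delta e.
have := h 1; have := h (-1).
have := diag_le1 i; have := diag_le1 j; rewrite ler_norml => *; apply/andP; split; lra.
Qed.

Lemma densities_compact S a : compact (densities S a).
Proof.
apply: (@bounded_closed_compact_mx _ _ _ _ 1).
  by move=> Q [pQ tQ _] i j; exact: density_entry_le1.
have tr_cont A : continuous (fun Q => \tr (A *m Q)).
  have -> : (fun Q => \tr (A *m Q)) = (fun Q => \sum_i \sum_j Q j i * A i j).
    apply/funext => Q; apply: eq_bigr => i _; rewrite mxE.
    by apply: eq_bigr => j _; rewrite mulrC.
  by apply: continuous_sum => i; apply: continuous_sum => j; exact: coordM_continuous.
have mul_cont B i j : continuous (fun Q => (Q *m B) i j).
  under eq_fun do rewrite mxE.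
  by apply: continuous_sum => k; exact: coordM_continuous.
have -> : densities S a =
    \bigcap_(ij in [set: 'I_d * 'I_d]) [set Q : 'M[R]_d | Q ij.1 ij.2 - Q ij.2 ij.1 = 0]
    `&` \bigcap_(v in [set: 'cV[R]_d]) [set Q | 0 <= \tr (v *m v^T *m Q)]
    `&` [set Q | \tr (1%:M *m Q) = 1]
    `&` \bigcap_(ij in [set: 'I_d * 'I_d]) [set Q | (Q *m (S - a%:M)) ij.1 ij.2 = 0].
  apply/seteqP; split => Q.
    move=> /densitiesE[[/symmxP sQ pQ] tQ eQ]; repeat split.
    - by move=> [i j] _ /=; rewrite -{1}sQ mxE subrr.
    - by move=> v _; rewrite /= -qf_trace.
    - by rewrite /= mul1mx.
    - by move=> [i j] _ /=; rewrite eQ mxE.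
  move=> [[[sQ pQ] tQ] eQ]; apply/densitiesE; split; last 2 first.
  - by move: tQ; rewrite /= mul1mx.
  - by apply/matrixP => i j; rewrite [RHS]mxE; exact: (eQ (i, j)).
  split; last by move=> v; rewrite qf_trace; exact: pQ.
  apply/symmxP/matrixP => i j; rewrite mxE; apply/eqP; rewrite -subr_eq0.
  by apply/eqP; exact: (sQ (j, i)).
apply: closedI; [apply: closedI; [apply: closedI|]|].
- apply: closed_bigI => -[i j] _.
  apply: (@preimage_closed _ _ (fun Q : 'M[R]_d => Q i j - Q j i) [set 0]); last exact: closed_eq.
  move=> Q _; exact: cvgB (@coord_continuous R d d i j Q) (@coord_continuous R d d j i Q).
- apply: closed_bigI => v _.
  apply: (@preimage_closed _ _ (fun Q : 'M[R]_d => \tr (v *m v^T *m Q)) [set x | 0 <= x]); last exact: closed_ge.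
  by move=> Q _; exact: tr_cont.
- apply: (@preimage_closed _ _ (fun Q : 'M[R]_d => \tr (1%:M *m Q)) [set 1]); last exact: closed_eq.
  by move=> Q _; exact: tr_cont.
- apply: closed_bigI => -[i j] _.
  apply: (@preimage_closed _ _ (fun Q : 'M[R]_d => (Q *m (S - a%:M)) i j) [set 0]); last exact: closed_eq.
  by move=> Q _; exact: mul_cont.
Qed.

(** The row space of Q lies in the line spanned by u^T, so by symmetry Q is
    a multiple of u u^T, and the trace fixes the factor. *)
Lemma density_simple S a u Q : S \is symmetricmx -> sphere u -> S *m u = a *: u ->
  \rank (eigenspace S a) = 1%N -> densities S a Q -> Q = u *m u^T.
Proof.
move=> /symmxP sS uS Su rk [[/symmxP sQ _] tQ QE].
have uE : (u^T <= eigenspace S a)%MS.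
  apply/eigenspaceP; rewrite -{1}sS -trmx_mul Su linearZ //.
have u0 : u^T != 0.
  by rewrite trmx_eq0 -qf1_eq0 uS oner_eq0.
have Eu : (eigenspace S a <= u^T)%MS.
  by have [_ <-] := mxrank_leqif_sup uE; rewrite rk rank_rV u0.
have /submxP[w Qw] := submx_trans QE Eu.
have uu : u^T *m u = 1%:M by rewrite [LHS]mx11_scalar; move: uS; rewrite /sphere /= mulmx1 => ->.
have wE : w = Q *m u by rewrite Qw -mulmxA uu mulmx1.
have wu : w = (u^T *m w) 0 0 *: u.
  have : Q = u *m w^T by rewrite -sQ Qw trmx_mul trmxK.
  move=> QE'; rewrite {1}wE QE' -mulmxA [w^T *m u]mx11_scalar mul_mx_scalar; congr (_ *: _).
  by rewrite -[w^T *m u]trmxK trmx_mul trmxK mxE.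
have QkE : Q = (u^T *m w) 0 0 *: (u *m u^T) by rewrite {1}Qw {1}wu -scalemxAl.
have uu1 : \tr (u *m u^T) = 1 by move: uS; rewrite /sphere /= qf_trace mulmx1.
by move: tQ; rewrite QkE linearZ /= uu1 mulr1 => ->; rewrite scale1r.
Qed.

End Densities.

(** * Descent along the minimum-norm direction *)

Section Geodesic.
Variables (R : realType) (d : nat).
Implicit Types (P Z : 'M[R]_d).

Lemma frob_orth (W X : 'M[R]_d) : W *m W^T = 1%:M -> frob (W *m X *m W^T) = frob X.
Proof.
move=> /orthC WW; rewrite /frob; congr (Num.sqrt _).
rewrite !trmx_mul trmxK !mulmxA mxtrace_mulC !mulmxA WW mul1mx.
by rewrite -(mulmxA _ W^T) WW mulmx1.
Qed.

Lemma frobZ a (X : 'M[R]_d) : frob (a *: X) = `|a| * frob X.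
Proof.
rewrite /frob [(_ *: _)^T]linearZ /= -scalemxAl -scalemxAr scalerA linearZ /= -expr2.
by rewrite sqrtrM ?sqr_ge0 // sqrtr_sqr.
Qed.

(** With G_s = C e^(s Z) C and C the square root of P, the matrix
    W = G_s^(-1/2) C e^(s Z / 2) is orthogonal and conjugates e^((t - s) Z) to
    G_s^(-1/2) G_t G_s^(-1/2), so the logarithm of the latter is the orthogonal
    conjugate of (t - s) Z. *)
Lemma aidist_expm P Z (s t : R) : spd P -> Z \is symmetricmx ->
  aidist (sqrtm P *m expm (s *: Z) *m sqrtm P)
         (sqrtm P *m expm (t *: Z) *m sqrtm P) = frob Z * `|t - s|.
Proof.
move=> sP sZ; have [sC CC] := sqrtm_spd sP.
have symC := symmxP _ (spd_sym sC); move: (sqrtm P) sC CC symC => C sC CC symC.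
have sG : spd (C *m expm (s *: Z) *m C).
  rewrite -{1}symC; apply: spd_congr; [exact: spd_unit|exact/expm_spd/symZ].
rewrite /aidist /whiten; have [sK KK] := sqrtm_spd sG.
move: (sqrtm _) sK KK => K sK KK; have uK := spd_unit sK.
have symKi := symmxP _ (sym_inv (spd_sym sK)).
pose F := expm ((s / 2) *: Z).
have symF : F^T = F by apply/symmxP/spd_sym/expm_spd/symZ.
pose W := invmx K *m C *m F.
have WT : W^T = F *m C *m invmx K by rewrite /W !trmx_mul symKi symC symF mulmxA.
have FF : F *m F = expm (s *: Z) by rewrite /F expmD //; congr (expm (_ *: _)); field.
have WW : W *m W^T = 1%:M.
  rewrite WT /W !mulmxA -(mulmxA _ F F) FF -!(mulmxA (invmx K)) -KK !mulmxA.
  by rewrite mulVmx // mul1mx mulmxV.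
have FeF : F *m expm ((t - s) *: Z) *m F = expm (t *: Z).
  by rewrite /F !expmD //; congr (expm (_ *: _)); field.
have WE : W *m expm ((t - s) *: Z) *m W^T =
    invmx K *m (C *m expm (t *: Z) *m C) *m invmx K.
  by rewrite WT /W -FeF !mulmxA.
rewrite -WE (logm_conj_expm WW); last exact: symZ.
by rewrite (frob_orth _ WW) frobZ mulrC.
Qed.

End Geodesic.

Section RightDerivative.
Variable R : realType.

Lemma right_derivative_squeeze (f : R -> R) (a l : R) :
  (forall t, 0 < t -> f a + t * l <= f (a + t)) ->
  (forall e, 0 < e -> exists2 t0, 0 < t0 &
    forall t, 0 < t < t0 -> f (a + t) <= f a + t * (l + e)) ->
  right_derivative f a l.
Proof.
move=> lo hi; apply/cvgrPdist_le => e e0; have [t0 t00 ht0] := hi e e0.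
near=> t.
have t_gt0 : 0 < t by near: t; exact: nbhs_right_gt.
have tt0 : t < t0 by near: t; exact: nbhs_right_lt.
have := lo t t_gt0; have := ht0 t; rewrite t_gt0 tt0 => /(_ isT) h1 h2.
have b1 : l <= t^-1 * (f (a + t) - f a) by rewrite ler_pdivlMl // lerBrDl.
have b2 : t^-1 * (f (a + t) - f a) <= l + e by rewrite ler_pdivrMl // lerBlDl.
rewrite ler_norml; apply/andP; split; lra.
Unshelve. all: by end_near.
Qed.

End RightDerivative.

Section MarginalSet.
Variables (R : realType) (m n : nat).
Hypotheses (m0 : (0 < m)%N) (n0 : (0 < n)%N).
Implicit Types (S Q M Z g : 'M[R]_(n * m)).

Lemma nm_gt0 : (0 < n * m)%N. Proof. by rewrite muln_gt0 n0 m0. Qed.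

Lemma log_kron_pr_linear : linear (@log_kron_pr R m n).
Proof.
move=> a M N; rewrite /log_kron_pr /kron_sum !linearP /=.
move: (ptrace1 M) (ptrace1 N) (ptrace2 M) (ptrace2 N) => A A' B B'.
apply/matrixP => i j; rewrite !mxE; ring.
Qed.

HB.instance Definition _ := GRing.isLinear.Build _ _ _ _ (@log_kron_pr R m n) log_kron_pr_linear.

(** Only the projection of a matrix is seen by elements of the subspace. *)
Lemma trace_log_kron_pr M Z : log_kron Z -> \tr (log_kron_pr M *m Z) = \tr (M *m Z).
Proof.
move=> lZ; have := log_kron_pr_orth m0 n0 M lZ.
rewrite (symmxP _ (log_kron_sym lZ)) mxtrace_mulC mulmxBl linearB /= => /eqP.
by rewrite subr_eq0 => /eqP.
Qed.

Lemma density_diff_sym S Q Q' a b : densities S a Q -> densities S b Q' ->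
  Q - Q' \is symmetricmx.
Proof. by move=> [[sQ _] _ _] [[sQ' _] _ _]; exact: symB. Qed.

Lemma marg_setE S : marg_set S =
  (fun D => log_kron_pr (D.2 - D.1)) @` (Dplus S `*` Dminus S).
Proof.
apply/seteqP; split => _ [Q [Qp Qm] <-]; exists Q => //.
  by rewrite proj_log_kronE //; exact: density_diff_sym Qm Qp.
by rewrite proj_log_kronE //; exact: density_diff_sym Qm Qp.
Qed.

Lemma marg_set_compact S : compact (marg_set S).
Proof.
rewrite marg_setE; apply: continuous_compact; last first.
  by apply: compact_setX; exact: densities_compact.
apply: continuous_subspaceT => Q.
have cB : continuous_at Q (fun Q : 'M[R]_(n * m) * 'M[R]_(n * m) => Q.2 - Q.1).
  exact: cvgB cvg_snd cvg_fst.
exact: continuous_comp cB (@linear_mxmx_continuous _ _ _ _ _ (@log_kron_pr R m n) _).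
Qed.

Lemma marg_set_segment S : segment_closed (marg_set S).
Proof.
rewrite marg_setE => _ _ s [Q [Qp Qm] <-] [Q' [Qp' Qm'] <-] s01.
exists (s *: Q.1 + (1 - s) *: Q'.1, s *: Q.2 + (1 - s) *: Q'.2).
  by split; exact: densities_convex.
by rewrite /= opprD addrACA -!scalerBr linearD !linearZ.
Qed.

Lemma marg_set_convex S : convex_set (marg_set S : set (convex_lmodType 'M[R]_(n * m))).
Proof.
move=> x y l; rewrite !inE => xS yS.
have := @marg_set_segment S x y l%:num xS yS; apply.
by apply/andP; split.
Qed.

Lemma marg_set_nonempty S : S \is symmetricmx -> marg_set S !=set0.
Proof.
move=> sS; have [Qp DQp] := densities_nonempty sS (lmaxP nm_gt0 sS).2.
have [Qm DQm] := densities_nonempty sS (lminP nm_gt0 sS).2.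
by exists (proj_log_kron (Qm - Qp)); exists (Qp, Qm).
Qed.

Lemma marg_set_log_kron S g : marg_set S g -> log_kron g.
Proof.
rewrite marg_setE => -[Q [Qp Qm] <-]; apply: log_kron_pr_in.
exact: density_diff_sym Qm Qp.
Qed.

(** By the variational inequality the pairing of Q- - Q+ with g is at least
    |g|^2 for all densities, with equality for the pair that defines g. Equality
    feeds the subgradient bound; the inequality, applied to one rank-one and one
    optimal density, bounds v^T g v on each extreme eigenspace. *)
Lemma ln_kappa_descent S g : spd S ->
  argmin (marg_set S) (@frob R (n * m) (n * m)) g ->
  (forall t, 0 < t -> ln (lmax S / lmin S) + t * (- frob g ^+ 2) <=
     ln (kappa (expm (- t *: g)) S)) /\
  (forall e, 0 < e -> exists2 t0, 0 < t0 & forall t, 0 < t < t0 ->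
     ln (kappa (expm (- t *: g)) S) <=
     ln (lmax S / lmin S) + t * (- frob g ^+ 2 + e)).
Proof.
move=> sS gmin; have sS' := spd_sym sS.
have lg := marg_set_log_kron gmin.1; have sg := log_kron_sym lg.
have symg := symmxP _ sg.
have [Qs [Qsp Qsm] gE] : ((fun D => log_kron_pr (D.2 - D.1)) @` (Dplus S `*` Dminus S)) g.
  by rewrite -marg_setE; exact: gmin.1.
have gQ : \tr (Qs.2 *m g) - \tr (Qs.1 *m g) = frob g ^+ 2.
  by rewrite -linearB -mulmxBl /= -trace_log_kron_pr // gE frob_sqr symg.
have var Q Q' : Dplus S Q -> Dminus S Q' ->
      frob g ^+ 2 <= \tr (Q' *m g) - \tr (Q *m g).
  move=> DQ DQ'; rewrite -linearB -mulmxBl /= -trace_log_kron_pr // frob_sqr.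
  have mQ : marg_set S (log_kron_pr (Q' - Q)) by rewrite marg_setE; exists (Q, Q').
  have := min_norm_variational (@marg_set_segment S) gmin mQ.
  by rewrite (symmxP _ (log_kron_sym (marg_set_log_kron mQ))).
split=> [t t0|e e0].
  have := ln_kappa_ge nm_gt0 sS (symZ (- t) sg) Qsp Qsm.
  by rewrite -scalemxAr linearZ /= mulmxBl linearB /= gQ mulNr mulrN.
have e2 : 0 < e / 2 by rewrite divr_gt0.
have hp v : sphere v -> S *m v = lmax S *: v -> qf g v < \tr (Qs.1 *m g) + e / 2.
  move=> vS Sv; have := var _ _ (outer_density sS' vS Sv) Qsm.
  rewrite -gQ -qf_trace; lra.
have hm v : sphere v -> S *m v = lmin S *: v -> - qf g v < - \tr (Qs.2 *m g) + e / 2.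
  move=> vS Sv; have := var _ _ Qsp (outer_density sS' vS Sv).
  rewrite -gQ -qf_trace; lra.
have [t0 t00 ht] := ln_kappa_le nm_gt0 sS sg hp hm.
exists t0 => // t tt; apply: le_trans (ht t tt) _.
rewrite lerD2l ler_wpM2l //; first by case/andP: tt => /ltW.
rewrite -gQ; lra.
Qed.

End MarginalSet.

Section Conditioning.
Variables (R : realType) (d : nat).

(** Generalized eigenvalues are invariant under congruence by the square root
    of P. *)
Lemma kappa_whiten (P H E : 'M[R]_d) : spd P ->
  kappa (sqrtm P *m E *m sqrtm P) H = kappa E (whiten P H).
Proof.
move=> sP; have [sC _] := sqrtm_spd sP.
rewrite /kappa -{1 2}(whitenK H sP).
by rewrite !gen_eigenvalues_congr ?spd_unit //; exact: spd_sym.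
Qed.

Lemma kappa_self (P H : 'M[R]_d) : spd P -> spd H ->
  kappa P H = lmax (whiten P H) / lmin (whiten P H).
Proof.
move=> sP sH; have [_ CC] := sqrtm_spd sP.
rewrite -{1}CC -[X in X *m _]mulmx1 kappa_whiten // /kappa /lmax /lmin.
by rewrite eigenvalue_gen //; exact/spd_sym/whiten_spd.
Qed.

End Conditioning.

Unset Implicit Arguments.

Theorem corollary5p12 (R : realType) (m n : nat) (hm : (1 <= m)%N) (hn : (1 <= n)%N)
    (H P : 'M[R]_(n * m)) (hH : spd H)
    (hP : argmin (@kron_family R m n) (aidist H) P) :
  let S := whiten P H in
  [/\ compact (marg_set S),
      convex_set (marg_set S : set (convex_lmodType 'M[R]_(n * m))),
      exists! g, argmin (marg_set S) (@frob R (n * m) (n * m)) g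
    & forall gstar, argmin (marg_set S) (@frob R (n * m) (n * m)) gstar ->
      let mu_marg := frob gstar in
      let Gt (t : R) := sqrtm P *m expm (- t *: gstar) *m sqrtm P in
      [/\ mu_marg = 0 <->
            argmin (@kron_family R m n) (fun G => ln (kappa G H)) P,
          0 < mu_marg ->
            geodesic_in (@kron_family R m n) Gt /\
            right_derivative (fun t => ln (kappa (Gt t) H)) 0 (- mu_marg ^+ 2),
          \rank (eigenspace S (lmax S)) = 1%N ->
          \rank (eigenspace S (lmin S)) = 1%N ->
          forall up um : 'cV[R]_(n * m),
            frob up = 1 -> S *m up = lmax S *: up ->
            frob um = 1 -> S *m um = lmin S *: um ->
            gstar = proj_log_kron (um *m um^T - up *m up^T)
        & forall Qp Qm : 'M[R]_(n * m),
            argmin (Dplus S `*` Dminus S)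
              (fun Q => frob (proj_log_kron (Q.2 - Q.1))) (Qp, Qm) ->
            gstar = proj_log_kron (Qm - Qp)]].
Proof.
move=> S; have [KP _] := hP.
have sP := kron_spd KP; have sS : spd S := whiten_spd sP hH; have sS' := spd_sym sS.
have [g0 g0min] := min_norm_exists (@marg_set_compact R m n hm hn S) (marg_set_nonempty hm hn sS').
have uniq := min_norm_unique (@marg_set_segment R m n hm hn S).
split.
- exact: marg_set_compact.
- exact: marg_set_convex.
- by exists g0; split=> // g; exact: uniq.
move=> g gmin mu Gt.
have lg := marg_set_log_kron hm hn gmin.1; have sg := log_kron_sym lg.
have kGt t : kappa (Gt t) H = kappa (expm (- t *: g)) S by rewrite /Gt kappa_whiten.
have kP : kappa P H = lmax S / lmin S by rewrite kappa_self.
have KGt t : kron_family (Gt t).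
  by apply: kron_congr; [exact: kron_sqrtm|exact/kron_expm/log_kronZ].
have [lo hi] := ln_kappa_descent hm hn sS gmin.
split.
- split=> [mu0|Pmin].
    split=> // G KG; have [Z lZ ZE] : exists2 Z, log_kron Z & whiten P G = expm Z.
      by apply: kron_exists_log; apply: kron_congr => //; exact/kron_invmx/kron_sqrtm.
    rewrite -(whitenK G sP) kappa_whiten // ZE kP.
    move: gmin.1; rewrite marg_setE // => -[Q [Qp Qm] QE].
    have := ln_kappa_ge (nm_gt0 hm hn) sS (log_kron_sym lZ) Qp Qm.
    rewrite -trace_log_kron_pr // QE.
    have -> : g = 0 by apply: normsq_eq0; rewrite -frob_sqr -/mu mu0 expr0n.
    by rewrite mul0mx mxtrace0 addr0.
  apply/eqP; rewrite eq_le sqrtr_ge0 andbT leNgt; apply/negP => mu0.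
  have e0 : 0 < mu ^+ 2 / 2 by rewrite divr_gt0 // exprn_gt0.
  (* half of the slope is kept, so the value drops strictly below the one at P *)
  have [t0 t00 ht] := hi _ e0.
  have t2 : 0 < t0 / 2 < t0 by lra.
  have := Pmin.2 _ (KGt (t0 / 2)); rewrite kGt kP => /le_trans /(_ (ht _ t2)).
  rewrite -/mu; have : 0 < t0 / 2 * (mu ^+ 2 / 2) by rewrite mulr_gt0 //; case/andP: t2.
  lra.
- move=> mu0; split.
    split=> //; exists mu; first exact: sqrtr_ge0.
    move=> s t; rewrite /Gt aidist_expm //; congr (_ * _).
    by rewrite -opprB normrN opprK addrC.
  have k0 : ln (kappa (Gt 0) H) = ln (lmax S / lmin S).
    rewrite -kP; congr (ln (kappa _ H)).
    by rewrite /Gt oppr0 scale0r expm0 mulmx1; case: (sqrtm_spd sP).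
  apply: right_derivative_squeeze => [t t0|e e0].
    by rewrite add0r k0 kGt; exact: lo.
  have [t0 t00 ht] := hi e e0; exists t0 => // t tt.
  by rewrite add0r k0 kGt; exact: ht.
- move=> rp rm up um /frob_qf1 up1 Sup /frob_qf1 um1 Sum.
  have [Q [Qp Qm] <-] := gmin.1.
  by rewrite (density_simple sS' up1 Sup rp Qp) (density_simple sS' um1 Sum rm Qm).
- move=> Qp Qm [DQ Qmin]; apply: uniq => //; split; first by exists (Qp, Qm).
  by move=> _ [Q DQ' <-]; exact: Qmin.
Qed.
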